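(* There is a constant $\gamma$ with $0\le\gamma<1$, depending neither on the matrix $A$ nor on the pivot strategy, such that the following holds. Let $A$ be any real symmetric $4\times 4$ matrix, let $\mathcal{O}$ be any ordering of $\mathbf{P}_4=\{(r,s)\mid 1\le r<s\le 4\}$, and for $t\ge 0$ let $A^{[t]}$ be the matrix obtained from $A$ by applying $t$ sweeps of the cyclic Jacobi method defined by the pivot strategy $I_{\mathcal{O}}$. Then $$S(A^{[t+3]})\le \gamma\, S(A^{[t]}),\qquad t\ge 1.$$
   Context: Off-norm: for a real symmetric $n\times n$ matrix $X=(x_{rs})$, $S(X)=\sqrt{\sum_{i=1}^{n-1}\sum_{j=i+1}^{n}x_{ij}^2}$. Plane rotations: for $p<q$, $R(p,q,\psi)$ is the $n\times n$ matrix that equals the identity except that its $(p,p)$ and $(q,q)$ entries are $\cos\psi$, its $(p,q)$ entry is $-\sin\psi$ and its $(q,p)$ entry is $\sin\psi$. Orderings and cyclic strategies: let $\mathbf{P}_4=\{(r,s)\mid 1\le r<s\le 4\}$ and $N=6$. An ordering $\mathcal{O}=(i_0,j_0),(i_1,j_1),\ldots,(i_5,j_5)$ of $\mathbf{P}_4$ is a listing of all six elements of $\mathbf{P}_4$, each exactly once (there are $720$ orderings). The cyclic pivot strategy $I_{\mathcal{O}}$ is the function on $\{0,1,2,\ldots\}$ given by $I_{\mathcal{O}}(k)=(i_{\tau(k)},j_{\tau(k)})$, where $0\le\tau(k)\le 5$ and $k\equiv\tau(k)\pmod 6$. Jacobi method: given a real symmetric $A$ and the strategy $I_{\mathcal{O}}$,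 the method generates $A^{(0)}=A$ and $A^{(k+1)}=R_k^TA^{(k)}R_k$, $k\ge 0$, where $R_k=R(i,j,\phi_k)$, $(i,j)=I_{\mathcal{O}}(k)$ is the pivot pair, and $\phi_k\in[-\frac{\pi}{4},\frac{\pi}{4}]$ is determined by $\tan(2\phi_k)=2a_{ij}^{(k)}/(a_{ii}^{(k)}-a_{jj}^{(k)})$, where $A^{(k)}=(a^{(k)}_{rs})$; this annihilates the pivot element, i.e. $a_{ij}^{(k+1)}=0$. In the degenerate cases: if $a_{ij}^{(k)}=0$ then $\phi_k=0$; if $a_{ii}^{(k)}=a_{jj}^{(k)}$ and $a_{ij}^{(k)}\neq 0$ then $\phi_k\in\{\frac{\pi}{4},-\frac{\pi}{4}\}$. A sweep (cycle) consists of $6$ consecutive steps; $A^{[t]}=A^{(6t)}$ is the matrix after $t$ sweeps. *)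

(* Defs.v *)
From HB Require Import structures.
From mathcomp Require Import all_boot all_order all_algebra.
From mathcomp Require Import reals trigo.

Set Implicit Arguments.
Unset Strict Implicit.
Unset Printing Implicit Defensive.

Import Order.TTheory GRing.Theory Num.Theory.

Local Open Scope ring_scope.

(* Rows and columns are numbered from 0 instead of 1. *)

Definition off_norm (R : realType) (n : nat) (X : 'M[R]_n) : R :=
  Num.sqrt (\sum_(i < n) \sum_(j < n | (i < j)%N) X i j ^+ 2).

(* Only meaningful for p != q. *)
Definition rotation (R : realType) (n : nat) (p q : 'I_n) (psi : R) : 'M[R]_n :=
  \matrix_(r, s)
    if ((r, s) == (p, p)) || ((r, s) == (q, q)) then cos psi
    else if (r, s) == (p, q) then - sin psi
    else if (r, s) == (q, p) then sin psi
    else (r == s)%:R.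

Definition P4 : {set 'I_4 * 'I_4} := [set rs : 'I_4 * 'I_4 | (rs.1 < rs.2)%N].

Definition is_ordering (O : 6.-tuple ('I_4 * 'I_4)) : Prop :=
  uniq O /\ O =i P4.

Definition tau (k : nat) : 'I_6 := Ordinal (ltn_pmod k (isT : (0 < 6)%N)).

Definition cyclic_strategy (O : 6.-tuple ('I_4 * 'I_4)) (k : nat) : 'I_4 * 'I_4 :=
  tnth O (tau k).

Definition jacobi_angle (R : realType) (n : nat) (X : 'M[R]_n) (i j : 'I_n)
    (phi : R) : Prop :=
  - (pi / 4) <= phi <= pi / 4 /\
  (if X i j == 0 then phi = 0
   else if X i i == X j j then phi = pi / 4 \/ phi = - (pi / 4)
   else tan (2 * phi) = 2 * X i j / (X i i - X j j)).

Fixpoint jacobi_iterate (R : realType) (n : nat) (I : nat -> 'I_n * 'I_n)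
    (phi : nat -> R) (A : 'M[R]_n) (k : nat) : 'M[R]_n :=
  if k is k'.+1 then
    let Rk := rotation (I k').1 (I k').2 (phi k') in
    Rk^T *m jacobi_iterate I phi A k' *m Rk
  else A.

(* The angles enter as a sequence because the method does not determine them:
   either sign is allowed when the two diagonal entries coincide. *)
Definition jacobi_angles (R : realType) (n : nat) (I : nat -> 'I_n * 'I_n)
    (A : 'M[R]_n) (phi : nat -> R) : Prop :=
  forall k, jacobi_angle (jacobi_iterate I phi A k) (I k).1 (I k).2 (phi k).

Definition after_sweeps (R : realType) (O : 6.-tuple ('I_4 * 'I_4))
    (phi : nat -> R) (A : 'M[R]_4) (t : nat) : 'M[R]_4 :=
  jacobi_iterate (cyclic_strategy O) phi A (6 * t).

(* Main.v *)
Require Import Defs.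
From mathcomp Require Import all_boot all_order all_algebra.
From mathcomp Require Import reals trigo.
From mathcomp Require Import boolp classical_sets topology normedtype derive.
From mathcomp Require Import ring lra.

Set Implicit Arguments.
Unset Strict Implicit.
Unset Printing Implicit Defensive.

Import Order.TTheory GRing.Theory Num.Theory.
Import numFieldNormedType.Exports.

Local Open Scope ring_scope.

(** Write S^2 for the sum of the squares of the six entries above the diagonal.  A Jacobi
    step with pivot pq annihilates a_pq and rotates the pairs (a_pr, a_qr), so it
    lowers S^2 by exactly a_pq^2.  For each of the 720 orderings there is
    a delta > 0 such that the 18 pivots of three sweeps take away at least
    delta S^2; with the smallest delta, gamma = sqrt (1 - delta).

    For 624 orderings the argument is that the cosines of the angles are at least 1 / 2.
    Suppose that nothing is lost: every pivot is 0 when its turn comes.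
    A rotation with nonzero cosine maps only (0, 0) to (0, 0), and never (y, 0) with
    y nonzero to (0, z).  Following which of the six entries can be nonzero is then
    a finite computation, and no nonzero pattern survives ([cyclic_orders]).
    Compactness of the set of angles turns this into a positive lower
    bound of the loss ([loss_lower_bound]).

    The other 96 orderings run, up to one shift, through three blocks of two disjoint
    pivots.  There, vectors that lose nothing do exist, with all angles equal to pi / 4
    or - pi / 4, and the diagonal entries have to be used.  Quaternions identify symmetric
    4 x 4 matrices modulo scalars with 3 x 3 matrices T, diagonal with diagonal and
    off-diagonal with off-diagonal entries; a block becomes one step of
    Kogbetliantz's method, which rotates two rows of T by an angle L and the same columns
    by an angle R to annihilate T_jk and T_kj ([block_svd_step]).  If all pivots are small
    with respect to S, then one off-diagonal entry of T carries nearly all of S,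
    and to stay out of the way of the next pivots it must be turned by nearly a right angle
    at each step, by L and R alternately.  A right angle on one side only means that the
    2 x 2 block has a diagonal much smaller than its other entries.  But these diagonal entries
    are what the preceding steps made out of earlier pivots, and the constraint
    |L| + |R| <= pi / 2 decides between L and R by comparing them.  The resulting
    inequalities are contradictory unless a block has both pivots equal to 0
    ([svd_cascade]), and then the method does not rotate at all.  Here explicit constants
    replace compactness, because the limit angles alone are not contradictory. *)

(** * The Jacobi step *)

(** A Jacobi step as a relation between the two matrices, in terms of the cosine c
    and the sine s of its angle.  The formula for the tangent is cleared of its
    denominator, so that [step_tan] also covers equal diagonal entries. *)
Record jacobi_step (R : realType) (n : nat) (A B : 'M[R]_n) (p q : 'I_n)
    (c s : R) : Prop := JacobiStep {
  step_unit : c ^+ 2 + s ^+ 2 = 1;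
  step_angle : `|s| <= c;
  step_trivial : A p q = 0 -> s = 0;
  step_sym : B^T = B;
  step_p : forall r, r != p -> r != q -> B p r = c * A p r + s * A q r;
  step_q : forall r, r != p -> r != q -> B q r = c * A q r - s * A p r;
  step_rest : forall r t, r != p -> r != q -> t != p -> t != q -> B r t = A r t;
  step_pivot : B p q = 0;
  step_tan : (c ^+ 2 - s ^+ 2) * A p q = c * s * (A p p - A q q);
  step_pp : B p p = c ^+ 2 * A p p + 2 * c * s * A p q + s ^+ 2 * A q q;
  step_qq : B q q = s ^+ 2 * A p p - 2 * c * s * A p q + c ^+ 2 * A q q }.

Lemma sin_le_cos (R : realType) (x : R) :
  - (pi / 4) <= x <= pi / 4 -> `|sin x| <= cos x.
Proof.
move=> /andP[lx ux]; have pi0 : 0 < pi :> R := pi_gt0 R.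
have c0 : 0 <= cos x by apply: cos_ge0_pihalf; apply/andP; split; lra.
have c2 : 0 <= cos (x *+ 2).
  by apply: cos_ge0_pihalf; rewrite -mulr_natr; apply/andP; split; lra.
rewrite -(@ler_pXn2r _ 2) ?nnegrE // real_normK ?num_real //.
by move: c2; rewrite cos_mulr2n; have := cos2Dsin2 x; lra.
Qed.

(** Division by 0 gives 0, so that tan (2 x) = 0 if cos (2 x) = 0; the defining
    equation rules this out because the pivot is nonzero. *)
Lemma jacobi_angle_tan (R : realType) (n : nat) (A : 'M[R]_n) (p q : 'I_n) (x : R) :
  jacobi_angle A p q x ->
  (cos x ^+ 2 - sin x ^+ 2) * A p q = cos x * sin x * (A p p - A q q).
Proof.
move=> [_]; case: (eqVneq (A p q) 0) => [-> ->|pq0].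
  by rewrite sin0 !(mulr0, mul0r).
have c2E : cos (2 * x) = cos x ^+ 2 - sin x ^+ 2.
  by rewrite mulr_natl cos_mulr2n; have := cos2Dsin2 x; lra.
case: (eqVneq (A p p) (A q q)) => [->|pp_qq Ht].
  move=> Hx; rewrite subrr mulr0 -c2E.
  suff -> : cos (2 * x) = 0 by rewrite mul0r.
  case: Hx => ->.
    by rewrite (_ : 2 * _ = pi / 2) ?cos_pihalf //; field.
  by rewrite (_ : 2 * _ = - (pi / 2)) ?cosN ?cos_pihalf //; field.
have g0 : A p p - A q q != 0 by rewrite subr_eq0.
have c0 : cos (2 * x) != 0.
  apply: contra_neq pq0 => c0; move: Ht.
  rewrite /tan c0 invr0 mulr0 => /esym/eqP.
  by rewrite mulf_eq0 invr_eq0 (negPf g0) orbF mulf_eq0 pnatr_eq0 /= => /eqP.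
have s2E : sin (2 * x) = 2 * (cos x * sin x).
  by rewrite !mulr_natl sin_mulr2n.
move: Ht; rewrite /tan s2E => /(congr1 (fun z => z * cos (2 * x) * (A p p - A q q))).
rewrite divfK // [RHS]mulrAC divfK // => Ht.
by apply: (@mulfI _ 2); rewrite ?pnatr_eq0 // -c2E [LHS]mulrCA [LHS]mulrC -Ht; ring.
Qed.

Lemma mulmx_rotation_rest (R : realType) (n : nat) (p q : 'I_n) (x : R) (M : 'M[R]_n) i r :
  r != p -> r != q -> (M *m rotation p q x) i r = M i r.
Proof.
move=> rp rq; rewrite mxE (bigD1 r) //= big1 => [|l lr].
  by rewrite mxE !xpair_eqE (negPf rp) (negPf rq) !andbF /= eqxx mulr1 addr0.
by rewrite mxE !xpair_eqE (negPf rp) (negPf rq) !andbF /= (negPf lr) mulr0.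
Qed.

Lemma mulmx_rotation_p (R : realType) (n : nat) (p q : 'I_n) (x : R) (M : 'M[R]_n) i :
  p != q -> (M *m rotation p q x) i p = cos x * M i p + sin x * M i q.
Proof.
move=> pq; rewrite mxE (bigD1 p) //= (bigD1 q) 1?eq_sym //= big1 => [|l /andP[lp lq]].
  by rewrite !mxE !xpair_eqE !eqxx (negPf pq) (eq_sym q) (negPf pq) /=; ring.
by rewrite mxE !xpair_eqE (negPf lp) (negPf lq) /= mulr0.
Qed.

Lemma mulmx_rotation_q (R : realType) (n : nat) (p q : 'I_n) (x : R) (M : 'M[R]_n) i :
  p != q -> (M *m rotation p q x) i q = cos x * M i q - sin x * M i p.
Proof.
move=> pq; rewrite mxE (bigD1 p) //= (bigD1 q) 1?eq_sym //= big1 => [|l /andP[lp lq]].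
  by rewrite !mxE !xpair_eqE !eqxx (negPf pq) (eq_sym q) (negPf pq) /=; ring.
by rewrite mxE !xpair_eqE (negPf lp) (negPf lq) /= mulr0.
Qed.

Lemma jacobi_angle_step (R : realType) (n : nat) (A : 'M[R]_n) (p q : 'I_n) (x : R) :
  p != q -> A^T = A -> jacobi_angle A p q x ->
  jacobi_step A ((rotation p q x)^T *m A *m rotation p q x) p q (cos x) (sin x).
Proof.
move=> pq symA Hx; have Ht := jacobi_angle_tan Hx.
have symE i j : A i j = A j i by rewrite -[in LHS]symA mxE.
set Q := rotation p q x; set B := Q^T *m A *m Q.
have trE i j : (Q^T *m A) i j = (A *m Q) j i.
  by rewrite -[in LHS]symA -trmx_mul mxE.
have Bpr r : r != p -> r != q -> B p r = cos x * A p r + sin x * A q r.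
  move=> rp rq; rewrite /B mulmx_rotation_rest // trE mulmx_rotation_p //.
  by rewrite !(symE r).
have Bqr r : r != p -> r != q -> B q r = cos x * A q r - sin x * A p r.
  move=> rp rq; rewrite /B mulmx_rotation_rest // trE mulmx_rotation_q //.
  by rewrite !(symE r).
have Cpp : (Q^T *m A) p p = cos x * A p p + sin x * A p q.
  by rewrite trE mulmx_rotation_p.
have Cpq : (Q^T *m A) p q = cos x * A p q + sin x * A q q.
  by rewrite trE mulmx_rotation_p // symE.
have Cqp : (Q^T *m A) q p = cos x * A p q - sin x * A p p.
  by rewrite trE mulmx_rotation_q.
have Cqq : (Q^T *m A) q q = cos x * A q q - sin x * A p q.
  by rewrite trE mulmx_rotation_q // (symE q p).
split => //.
- exact: cos2Dsin2.
- by apply: sin_le_cos; case: Hx.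
- by case: Hx => _; case: eqP => // _ -> _; rewrite sin0.
- by rewrite /B !trmx_mul trmxK symA mulmxA.
- by move=> r t rp rq tp tq; rewrite /B mulmx_rotation_rest // trE mulmx_rotation_rest // symE.
- by rewrite /B mulmx_rotation_q // Cpp Cpq; move: Ht; lra.
- by rewrite /B mulmx_rotation_p // Cpp Cpq; ring.
- by rewrite /B mulmx_rotation_q // Cqp Cqq; ring.
Qed.

Lemma jacobi_step_swap (R : realType) (n : nat) (A B : 'M[R]_n) (p q : 'I_n) (c s : R) :
  A^T = A -> jacobi_step A B p q c s -> jacobi_step A B q p c (- s).
Proof.
move=> symA [cs1 le_sc triv symB Bp Bq Brest Bpq Ht Bpp Bqq].
have symE i j : A i j = A j i by rewrite -[in LHS]symA mxE.
have qpE := symE q p.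
split => //.
- by rewrite sqrrN.
- by rewrite normrN.
- by rewrite qpE => /triv ->; rewrite oppr0.
- by move=> r rq rp; rewrite Bq // mulNr.
- by move=> r rq rp; rewrite Bp // mulNr opprK.
- by move=> *; apply: Brest.
- by rewrite -symB mxE.
- by rewrite qpE sqrrN Ht; ring.
- by rewrite qpE Bqq; ring.
- by rewrite qpE Bpp; ring.
Qed.

(** * The six off-diagonal entries *)

(** The six pivots, numbered so that e and 5 - e are disjoint pairs. *)
Definition edges : seq ('I_4 * 'I_4) :=
  let i0 := @Ordinal 4 0 isT in let i1 := @Ordinal 4 1 isT in
  let i2 := @Ordinal 4 2 isT in let i3 := @Ordinal 4 3 isT in
  [:: (i0, i1); (i0, i2); (i0, i3); (i1, i2); (i1, i3); (i2, i3)].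

Definition edge (e : nat) : 'I_4 * 'I_4 := nth (ord0, ord0) edges e.

(** Extended by 0 beyond index 5, so that one step is an equality of functions. *)
Definition off_vec (R : realType) (A : 'M[R]_4) (i : nat) : R :=
  if (i < 6)%N then A (edge i).1 (edge i).2 else 0.

(** For the pivot pq numbered e, with r and t the two other indices: the numbers of
    the pairs (pr, qr) and (pt, qt), which the step rotates in the plane. *)
Definition rotated_pairs (e : nat) : (nat * nat) * (nat * nat) :=
  nth ((0, 0), (0, 0)) [:: ((1, 3), (2, 4)); ((0, 3), (2, 5)); ((0, 4), (1, 5));
    ((0, 1), (4, 5)); ((0, 2), (3, 5)); ((1, 2), (3, 4))]%N e.

Definition off_step (R : realType) (e : nat) (c s : R) (x : nat -> R) : nat -> R :=
  let: ((a, b), (g, d)) := rotated_pairs e in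
  fun i => if i == a then c * x a + s * x b
           else if i == b then c * x b - s * x a
           else if i == g then c * x g + s * x d
           else if i == d then c * x d - s * x g
           else if i == e then 0 else x i.

Definition off_sq (R : realType) (x : nat -> R) : R := \sum_(i < 6) x i ^+ 2.

Lemma off_sq_ge0 (R : realType) (x : nat -> R) : 0 <= off_sq x.
Proof. by apply: sumr_ge0 => i _; apply: sqr_ge0. Qed.

Lemma off_vec_step (R : realType) (A B : 'M[R]_4) (e : nat) (c s : R) :
  (e < 6)%N -> A^T = A -> jacobi_step A B (edge e).1 (edge e).2 c s ->
  off_vec B = off_step e c s (off_vec A).
Proof.
move=> e6 symA H; apply: funext => i.
have symAE j k : A j k = A k j by rewrite -[in LHS]symA mxE.
have symBE j k : B j k = B k j by rewrite -[in LHS](step_sym H) mxE.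
case: (ltnP i 6) => [i6|i6]; last first.
  rewrite {1}/off_vec ltnNge i6 /=; move: e6 i6; clear.
  by case: e => [|[|[|[|[|[|e]]]]]] // _; case: i => [|[|[|[|[|[|i]]]]]].
case: e e6 H => [|[|[|[|[|[|e]]]]]] //= _ H;
  case: i i6 => [|[|[|[|[|[|i]]]]]] //= _; rewrite /off_step /off_vec /=;
  first [ exact: step_pivot H | exact: (step_rest H)
        | rewrite (step_p H) //; congr (_ * _ + _ * _); first [reflexivity | exact: symAE]
        | rewrite (step_q H) //; congr (_ * _ - _ * _); first [reflexivity | exact: symAE]
        | rewrite symBE (step_p H) //; congr (_ * _ + _ * _); first [reflexivity | exact: symAE]
        | rewrite symBE (step_q H) //; congr (_ * _ - _ * _); first [reflexivity | exact: symAE] ].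
Qed.

(** Two planar rotations and one annihilated entry. *)
Lemma off_sq_step (R : realType) (e : nat) (c s : R) (x : nat -> R) :
  (e < 6)%N -> c ^+ 2 + s ^+ 2 = 1 ->
  off_sq (off_step e c s x) = off_sq x - x e ^+ 2.
Proof.
move=> e6 cs.
have rot (y z : R) : (c * y + s * z) ^+ 2 + (c * z - s * y) ^+ 2 = y ^+ 2 + z ^+ 2.
  by transitivity ((c ^+ 2 + s ^+ 2) * (y ^+ 2 + z ^+ 2)); [ring | rewrite cs mul1r].
rewrite /off_sq !big_ord_recl !big_ord0 /off_step.
have := rot (x (rotated_pairs e).1.1) (x (rotated_pairs e).1.2).
have := rot (x (rotated_pairs e).2.1) (x (rotated_pairs e).2.2).
by case: e e6 => [|[|[|[|[|[|e]]]]]] //= _; clear; lra.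
Qed.

Lemma off_norm_vec (R : realType) (A : 'M[R]_4) :
  off_norm A = Num.sqrt (off_sq (off_vec A)).
Proof.
congr Num.sqrt; rewrite /off_sq; under eq_bigr do rewrite big_mkcond /=.
rewrite !big_ord_recl !big_ord0 /= /off_vec /=.
have -> : lift ord0 (lift ord0 (lift ord0 ord0)) = @Ordinal 4 3 isT by apply: val_inj.
have -> : lift ord0 (lift ord0 ord0) = @Ordinal 4 2 isT by apply: val_inj.
have -> : lift ord0 ord0 = @Ordinal 4 1 isT by apply: val_inj.
have -> : ord0 = @Ordinal 4 0 isT by apply: val_inj.
by ring.
Qed.

Definition cyclic_jacobi (R : realType) (es : seq nat) (A : nat -> 'M[R]_4)
    (c s : nat -> R) : Prop :=
  forall k, jacobi_step (A k) (A k.+1) (edge (nth 0%N es (k %% 6))).1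
    (edge (nth 0%N es (k %% 6))).2 (c k) (s k).

Lemma off_sq_jacobi_step (R : realType) (A B : 'M[R]_4) (e : nat) (c s : R) :
  (e < 6)%N -> A^T = A -> jacobi_step A B (edge e).1 (edge e).2 c s ->
  off_sq (off_vec B) = off_sq (off_vec A) - A (edge e).1 (edge e).2 ^+ 2.
Proof.
move=> e6 symA H.
by rewrite (off_vec_step e6 symA H) (off_sq_step _ e6 (step_unit H)) {2}/off_vec e6.
Qed.

Lemma off_sq_nonincreasing (R : realType) (A : nat -> 'M[R]_4) (code : nat -> nat)
    (c s : nat -> R) m n :
  (A 0%N)^T = A 0%N -> (forall k, code k < 6)%N ->
  (forall k, jacobi_step (A k) (A k.+1) (edge (code k)).1 (edge (code k)).2 (c k) (s k)) ->
  (m <= n)%N -> off_sq (off_vec (A n)) <= off_sq (off_vec (A m)).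
Proof.
move=> symA0 code6 steps.
have symA k : (A k)^T = A k by case: k => // k; apply: step_sym (steps k).
elim: n => [|n IH]; first by rewrite leqn0 => /eqP ->.
rewrite leq_eqVlt => /orP[/eqP -> //|/IH]; apply: le_trans.
by rewrite (off_sq_jacobi_step (code6 n) (symA n) (steps n)) gerBl sqr_ge0.
Qed.

(** The squared pivots met along es, summed, when the cosines and sines are
    prescribed instead of being computed from the diagonal. *)
Fixpoint loss (R : realType) (es : seq nat) (c s : nat -> R) (x : nat -> R) : R :=
  if es is e :: es' then
    x e ^+ 2 + loss es' (fun k => c k.+1) (fun k => s k.+1) (off_step e (c 0%N) (s 0%N) x)
  else 0.

Lemma loss_ge0 (R : realType) es (c s x : nat -> R) : 0 <= loss es c s x.
Proof.
by elim: es c s x => [|e es IH] c s x //=; rewrite addr_ge0 ?sqr_ge0.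
Qed.

Lemma off_stepZ (R : realType) (r : R) e c s x :
  off_step e c s (fun i => r * x i) = (fun i => r * off_step e c s x i).
Proof.
apply: funext => i; rewrite /off_step.
by case: (rotated_pairs e) => [[a b] [g d]]; do !case: ifP => // _; ring.
Qed.

Lemma lossZ (R : realType) (r : R) es (c s x : nat -> R) :
  loss es c s (fun i => r * x i) = r ^+ 2 * loss es c s x.
Proof.
elim: es c s x => [|e es IH] c s x /=; first by rewrite mulr0.
by rewrite off_stepZ IH exprMn mulrDr.
Qed.

Lemma loss_jacobi_steps (R : realType) (A : nat -> 'M[R]_4) (es : seq nat) (c s : nat -> R) :
  (A 0%N)^T = A 0%N -> all (gtn 6) es ->
  (forall k, (k < size es)%N ->
     jacobi_step (A k) (A k.+1) (edge (nth 0%N es k)).1 (edge (nth 0%N es k)).2 (c k) (s k)) ->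
  loss es c s (off_vec (A 0%N)) = off_sq (off_vec (A 0%N)) - off_sq (off_vec (A (size es))).
Proof.
elim: es A c s => [|e es' IH] A c s symA /=; first by rewrite subrr.
move=> /andP[e6 es6] steps; have H0 := steps 0%N isT.
have := IH (fun k => A k.+1) (fun k => c k.+1) (fun k => s k.+1) (step_sym H0) es6
  (fun k => steps k.+1).
rewrite (off_vec_step e6 symA H0) (off_sq_step _ e6 (step_unit H0)) => ->.
by ring.
Qed.

(** * Zero patterns of lossless trajectories *)

Definition pattern (R : realType) (x : nat -> R) : seq bool :=
  [seq x i != 0 | i <- iota 0 6].

Fixpoint bitseqs (n : nat) : seq (seq bool) :=
  if n is m.+1 then [seq b :: w | b <- [:: true; false], w <- bitseqs m] else [:: [::]].

(** Whether a rotation with nonzero cosine can turn a pair with nonzero flags y, z into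
    one with flags y', z': zero is kept, and neither axis is carried onto the other.
    Conditionals, unlike boolean connectives, let the evaluation stop early. *)
Definition pair_compatible (y z y' z' : bool) : bool :=
  if y then if z then if y' then true else z' else y'
  else if z then z' else if y' then false else ~~ z'.

Definition compatible (e : nat) (w w' : seq bool) : bool :=
  let p := nth false w in let p' := nth false w' in
  if p e then false else if p' e then false else
  if p' (5 - e)%N == p (5 - e)%N then
    let: ((a, b), (g, d)) := rotated_pairs e in
    if pair_compatible (p a) (p b) (p' a) (p' b)
    then pair_compatible (p g) (p d) (p' g) (p' d) else false
  else false.

Definition next_patterns (L : seq (seq bool)) (e : nat) : seq (seq bool) :=
  [seq w' <- bitseqs 6 | has (fun w => compatible e w w') L].

(** The nonzero patterns that can be reached at the end of es if all pivots
    vanish when their turn comes. *)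
Definition survivors (es : seq nat) : seq (seq bool) :=
  foldl next_patterns [seq w <- bitseqs 6 | has id w] es.

Arguments next_patterns : simpl never.

Lemma mem_bitseqs (w : seq bool) : w \in bitseqs (size w).
Proof.
elim: w => [|b w IH] /=; first by rewrite inE.
by case: b; rewrite !mem_cat map_f ?orbT.
Qed.

(** A rotation is injective, and its nonzero diagonal coefficient c keeps y in the image
    of (y, 0) and z in the image of (0, z). *)
Lemma rotated_pair_compatible (R : realType) (c s y z : R) :
  0 < c ->
  pair_compatible (y != 0) (z != 0) (c * y + s * z != 0) (c * z - s * y != 0).
Proof.
move=> c0; rewrite /pair_compatible.
case: (eqVneq y 0) => [->|y0] /=; case: (eqVneq z 0) => [->|z0] /=.
- by rewrite !mulr0 subr0 addr0 eqxx.
- by rewrite mulr0 subr0 mulf_neq0 // gt_eqF.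
- by rewrite mulr0 addr0 mulf_neq0 // gt_eqF.
case: eqVneq => //= yz0; apply: contra_neq y0 => zy0.
have : (c ^+ 2 + s ^+ 2) * y = 0.
  by transitivity (c * (c * y + s * z) - s * (c * z - s * y));
    [ring | rewrite yz0 zy0 !mulr0 subrr].
move/eqP; rewrite mulf_eq0 gt_eqF => [/eqP //|].
by rewrite ltr_wpDr ?sqr_ge0 // exprn_gt0.
Qed.

Lemma pattern_compatible (R : realType) (e : nat) (c s : R) (x : nat -> R) :
  (e < 6)%N -> 0 < c -> x e = 0 ->
  compatible e (pattern x) (pattern (off_step e c s x)).
Proof.
move=> e6 c0 xe; have rot := rotated_pair_compatible s _ _ c0.
by case: e e6 xe => [|[|[|[|[|[|e]]]]]] // _ xe;
  rewrite /compatible /pattern /off_step /= xe !eqxx /= !rot.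
Qed.

Lemma survivors_of_lossless (R : realType) (es : seq nat) (c s x : nat -> R) :
  all (gtn 6) es -> (forall k, 0 < c k) -> loss es c s x = 0 ->
  has id (pattern x) -> survivors es != [::].
Proof.
move=> es6 c0 loss0 x0.
have : pattern x \in [seq w <- bitseqs 6 | has id w] by rewrite mem_filter x0 mem_bitseqs.
rewrite /survivors; move: [seq w <- bitseqs 6 | has id w] => L.
elim: es es6 c s c0 x loss0 {x0} L => [|e es IH] /= es6 c s c0 x loss0 L xL.
  by apply: contraTneq xL => ->.
case/andP: es6 => e6 es6; move/eqP: loss0; rewrite paddr_eq0 ?sqr_ge0 ?loss_ge0 //.
rewrite sqrf_eq0 => /andP[/eqP xe /eqP loss0].
apply: IH loss0 _ _ => //.
rewrite mem_filter mem_bitseqs andbT; apply/hasP; exists (pattern x) => //.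
exact: pattern_compatible.
Qed.

(** Three successive pairs of disjoint pivots; the two rotations of a pair commute. *)
Definition parallel (es : seq nat) : bool :=
  if es is [:: a; b; c; d; e; f] then [&& a + b == 5, c + d == 5 & e + f == 5]%N else false.

(** The 96 exceptions are genuine: if es or rot 1 es is parallel, there are nonzero
    lossless trajectories all of whose angles are pi / 4 or - pi / 4. *)
Lemma cyclic_orders :
  all (fun es => [|| survivors (es ++ es ++ es) == [::], parallel es | parallel (rot 1 es)])
    (permutations (iota 0 6)).
Proof. by vm_compute. Qed.

(** * Compactness of the set of angles *)

Local Open Scope classical_set_scope.

Lemma loss_continuous (R : realType) (T : topologicalType) es (c s x : T -> nat -> R) :
  (forall k, continuous (fun v => c v k)) -> (forall k, continuous (fun v => s v k)) ->
  (forall k, continuous (fun v => x v k)) ->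
  continuous (fun v => loss es (c v) (s v) (x v)).
Proof.
have cM (f g : T -> R) : continuous f -> continuous g -> continuous (fun v => f v * g v).
  by move=> cf cg v; apply: continuousM; [exact: cf | exact: cg].
have cD (f g : T -> R) : continuous f -> continuous g -> continuous (fun v => f v + g v).
  by move=> cf cg v; apply: continuousD; [exact: cf | exact: cg].
have cN (f : T -> R) : continuous f -> continuous (fun v => - f v).
  by move=> cf v; apply: continuousN; exact: cf.
elim: es c s x => [|e es IH] c s x cc cs cx /=; first exact: cst_continuous.
apply: (cD); first by apply: (cM).
apply: IH => [k|k|k]; [exact: cc | exact: cs |].
rewrite /off_step; case: (rotated_pairs e) => [[a b] [g d]].
case: (k == a); first by apply: (cD); apply: (cM).
case: (k == b); first by apply: (cD); [| apply: (cN)]; apply: (cM).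
case: (k == g); first by apply: (cD); apply: (cM).
case: (k == d); first by apply: (cD); [| apply: (cN)]; apply: (cM).
by case: (k == e); [exact: cst_continuous | exact: cx].
Qed.

(** The loss is continuous and homogeneous of degree 2, so it is enough to minimize it
    over a sphere times a box of cosines and sines, which is compact; the minimum
    is not 0 because a lossless trajectory would leave a surviving pattern. *)
Lemma loss_lower_bound (R : realType) (es : seq nat) :
  all (gtn 6) es -> survivors es = [::] ->
  exists2 delta : R, 0 < delta &
    forall c s x : nat -> R, (forall k, 1 / 2 <= c k <= 1) -> (forall k, -1 <= s k <= 1) ->
      (forall i, (6 <= i)%N -> x i = 0) ->
      delta * off_sq x <= loss es c s x.
Proof.
move=> es6 dead.
(* The coordinates (0, i), (1, i), (2, i) hold the vector, the cosines and the sines. *)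
pose T := prod_topology (fun _ : nat * nat => R).
pose x (v : T) i := v (0%N, i); pose c (v : T) i := v (1%N, i); pose s (v : T) i := v (2%N, i).
have coord i : continuous (fun v : T => v i) by exact: (@proj_continuous _ (fun _ => R)).
pose range (i : nat * nat) : set R :=
  (if i.1 == 1%N then `[1 / 2, 1] else `[-1, 1])%classic.
pose box : set T := [set v | forall i, range i (v i)].
have box_compact : compact box.
  apply: (@tychonoff _ (fun=> R) range) => i.
  by rewrite /range; case: ifP => _; apply: segment_compact.
have norm_continuous : continuous (fun v : T => off_sq (x v)).
  apply: continuous_big => [|i _]; first exact: add_continuous.
  by move=> v; apply: (@continuousM _ _ (fun v => x v i) (fun v => x v i)); exact: coord.
pose sphere : set T := [set v | off_sq (x v) = 1].
have sphere_closed : closed sphere.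
  by move/continuous_closedP: norm_continuous => /(_ _ (@closed_eq R 1)).
have K_compact : compact (box `&` sphere) by exact: compact_closedI.
have F_continuous : continuous (fun v : T => loss es (c v) (s v) (x v)).
  by apply: loss_continuous => k; exact: coord.
(* The first basis vector with all angles 0. *)
have [v0 Kv0] : (box `&` sphere) !=set0.
  exists (fun i => if i.1 == 0%N then (i.2 == 0%N)%:R else (i.1 == 1%N)%:R); split.
    by case=> [[|[|j]] [|k]]; rewrite /range /= in_itv /=; apply/andP; split; lra.
  by rewrite /sphere /off_sq /= !big_ord_recl big_ord0 /x /=; ring.
have [v Kv vmin] : exists2 v, v \in box `&` sphere & forall w, w \in box `&` sphere ->
    loss es (c v) (s v) (x v) <= loss es (c w) (s w) (x w).
  by apply: compact_EVT_min; [exists v0 | | exact: continuous_subspaceT].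
move: Kv; rewrite inE => -[boxv spherev].
have itvP (u : T) : box u -> forall k, 1 / 2 <= c u k <= 1.
  by move=> + k => /(_ (1%N, k)); rewrite /range /= in_itv.
exists (loss es (c v) (s v) (x v)).
  rewrite lt_neqAle loss_ge0 andbT eq_sym; apply/eqP => loss0.
  have c0 k : 0 < c v k by have /andP[+ _] := itvP v boxv k; lra.
  have := survivors_of_lossless es6 c0 loss0; rewrite dead => dead'.
  have x0 i : (i < 6)%N -> x v i = 0.
    move=> i6; apply/eqP; apply: contraT => xi.
    apply: dead'; apply/hasP; exists true => //; apply/mapP; exists i; rewrite ?xi //.
    by rewrite mem_iota.
  move: spherev; rewrite /sphere /= /off_sq big1 => [/eqP|i _].
    by rewrite eq_sym oner_eq0.
  by rewrite x0 ?expr0n.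
move=> c' s' x' Hc Hs Hx.
case: (eqVneq (off_sq x') 0) => [->|norm0]; first by rewrite mulr0 loss_ge0.
set r := Num.sqrt (off_sq x').
have r0 : 0 < r by rewrite sqrtr_gt0 lt_neqAle eq_sym norm0 off_sq_ge0.
have r2 : r ^+ 2 = off_sq x' by rewrite sqr_sqrtr ?off_sq_ge0.
pose w : T := fun i => if i.1 == 0%N then r^-1 * x' i.2 else if i.1 == 1%N then c' i.2 else s' i.2.
have -> : x' = fun i => r * x w i.
  by apply: funext => i; rewrite /x /w /= mulVKf ?gt_eqF.
have wnorm : off_sq (x w) = 1.
  rewrite /off_sq /x /w /=; under eq_bigr do rewrite exprMn.
  by rewrite -mulr_sumr -/(off_sq x') -r2 -exprMn mulVf ?gt_eqF // expr1n.
rewrite lossZ -[s']/(s w) -[c']/(c w).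
have -> : off_sq (fun i => r * x w i) = r ^+ 2.
  by rewrite /off_sq; under eq_bigr do rewrite exprMn; rewrite -mulr_sumr -/(off_sq (x w)) wnorm mulr1.
rewrite mulrC ler_wpM2l ?sqr_ge0 //; apply: vmin; rewrite inE; split => // -[[|[|j]] k];
  rewrite /range /w /= in_itv /=; [|exact: Hc|exact: Hs].
case: (ltnP k 6) => [k6|/Hx ->]; last by rewrite mulr0; apply/andP; split; lra.
rewrite -ler_norml -(@ler_pXn2r _ 2) ?nnegrE // real_normK ?num_real // expr1n -wnorm.
by rewrite /off_sq (bigD1 (Ordinal k6)) //= lerDl sumr_ge0 // => i _; apply: sqr_ge0.
Qed.

Local Close Scope classical_set_scope.

(** * The singular value step on 3 x 3 matrices *)

(** A 3 x 3 matrix T with rows and columns labelled j, l, k, just before a step in the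
    plane of j and k.  The entries T_kl and T_lk are absent: the previous step has
    annihilated them. *)
Record svd_state (R : realType) := SvdState {
  e_jl : R; e_lj : R; e_jk : R; e_kj : R; e_jj : R; e_kk : R; e_ll : R }.

(** A step of Kogbetliantz's method for the singular values of T: the rows j, k are
    rotated by an angle L and the columns j, k by an angle R, so that T_jk and T_kj
    vanish.  [svd_leL] and [svd_leR] say that |L| + |R| is at most pi / 2.  The new
    matrix is transposed and read with the labels l, k, j of the next step;
    transposing keeps a dominating entry in position jl for ever. *)
Record svd_step (R : realType) (u v : svd_state R) (cL sL cR sR : R) : Prop := SvdStep {
  svd_unitL : cL ^+ 2 + sL ^+ 2 = 1;
  svd_unitR : cR ^+ 2 + sR ^+ 2 = 1;
  svd_leL : `|sR| <= cL;
  svd_leR : `|sL| <= cR;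
  svd_trivial : e_jk u = 0 -> e_kj u = 0 -> cL = 1 /\ cR = 1;
  svd_jl : e_jl v = - sL * e_jl u;
  svd_lj : e_lj v = - sR * e_lj u;
  svd_jk : e_jk v = cL * e_jl u;
  svd_kj : e_kj v = cR * e_lj u;
  svd_jj : e_jj v = e_ll u;
  svd_kk : e_kk v = cL * cR * e_jj u + cL * sR * e_jk u + sL * cR * e_kj u + sL * sR * e_kk u;
  svd_ll : e_ll v = sL * sR * e_jj u - sL * cR * e_jk u - cL * sR * e_kj u + cL * cR * e_kk u;
  svd_jk0 : - (cL * sR * e_jj u) + cL * cR * e_jk u - sL * sR * e_kj u + sL * cR * e_kk u = 0;
  svd_kj0 : - (sL * cR * e_jj u) - sL * sR * e_jk u + cL * cR * e_kj u + cL * sR * e_kk u = 0 }.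

(** The estimates of [svd_small_angle] on absolute values: l and r are the small
    coefficients cL and |sR|, A, B, M, N the moduli of the entries jj, kk, jk, kj,
    and B', T' those of the new diagonal entries. *)
Lemma svd_small_angle_bounds (R : realType) (l r A B M N B' T' : R) :
  0 <= r -> r <= l -> l <= 1 / 100 -> 0 <= A -> 0 <= B -> 0 <= M -> 0 <= N ->
  98 / 100 * B <= r * N + l * (r * A) + l * M ->
  98 / 100 * A <= l * N + l * (r * B) + r * M ->
  98 / 100 * (l * M) <= B + r * N + l * (r * A) ->
  98 / 100 * (r * M) <= A + l * N + l * (r * B) ->
  98 / 100 * N <= B' + l * A + l * (r * M) + r * B ->
  98 / 100 * M <= T' + r * A + l * (r * N) + l * B ->
  B' <= N + l * A + l * (r * M) + r * B ->
  [/\ r <= 1 / 100,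
      [/\ A + B <= 3 / 100 * (M + N), N <= 11 / 10 * B' + 1 / 100 * (M + N) &
       M <= 11 / 10 * T' + 1 / 100 * (M + N)],
      B' <= 2 * N + A / 20,
      B' <= N + 1 / 100 * (M + N) &
      N <= M / 4 -> A <= 2 * B].
Proof.
move=> r0 rl l1 A0 B0 M0 N0 H1 H2 H3 H4 H5 H6 H7.
have l0 : 0 <= l by apply: le_trans rl.
have r1 : r <= 1 / 100 by apply: le_trans l1.
have rZ Z : 0 <= Z -> 0 <= r * Z by move=> Z0; rewrite mulr_ge0.
have rlZ Z : 0 <= Z -> r * Z <= l * Z by move=> Z0; rewrite ler_wpM2r.
have lZ Z : 0 <= Z -> l * Z <= 1 / 100 * Z by move=> Z0; rewrite ler_wpM2r.
have lrZ Z : 0 <= Z -> l * (r * Z) <= 1 / 100 * (r * Z).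
  by move=> Z0; rewrite lZ // rZ.
have AB : A + B <= 3 / 100 * (M + N).
  move: H1 H2 A0 B0 M0 N0 (lrZ _ A0) (lrZ _ B0) (rlZ _ A0) (rlZ _ B0) (rlZ _ M0) (rlZ _ N0)
    (lZ _ A0) (lZ _ B0) (lZ _ M0) (lZ _ N0); clear; lra.
split; first exact: r1.
- split=> //.
    move: H5 AB A0 B0 M0 N0 (lrZ _ M0) (rlZ _ B0) (rlZ _ M0)
      (lZ _ A0) (lZ _ B0) (lZ _ M0); clear; lra.
  move: H6 AB A0 B0 M0 N0 (lrZ _ N0) (rlZ _ A0) (rlZ _ N0)
      (lZ _ A0) (lZ _ B0) (lZ _ N0); clear; lra.
- have rB : 98 / 100 * (r * B) <= 1 / 50 * N + 1 / 100 * A + 1 / 100 * (r * M).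
    have X1 : r * (98 / 100 * B) <= r * (r * N + l * (r * A) + l * M) by rewrite ler_wpM2l.
    have X2 : r * (r * N) <= 1 / 100 * (1 / 100 * N).
      by apply: ler_pM => //; rewrite ?rZ // (le_trans (rlZ _ N0)) ?lZ.
    have X3 : r * (l * (r * A)) <= 1 / 100 * (1 / 100 * A).
      apply: ler_pM => //; first by rewrite mulr_ge0 ?rZ.
      have := lrZ _ A0; have := rlZ _ A0; have := lZ _ A0; move: A0; clear; lra.
    have X4 : r * (l * M) <= 1 / 100 * (r * M).
      by rewrite mulrCA lZ ?rZ.
    by move: X1 X2 X3 X4 A0 N0; clear; lra.
  move: H7 H4 rB A0 N0 (lZ _ A0) (lZ _ N0) (lrZ _ M0) (lrZ _ B0); clear; lra.
- move: H7 AB A0 B0 M0 N0 (lrZ _ M0) (rlZ _ B0) (rlZ _ M0)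
      (lZ _ A0) (lZ _ B0) (lZ _ M0); clear; lra.
- move=> NM.
  have lN : l * N <= l * (M / 4) by rewrite ler_wpM2l.
  move: H2 H3 lN A0 B0 (rlZ _ M0) (rlZ _ N0) (lrZ _ A0) (lrZ _ B0) (rlZ _ A0) (rlZ _ B0)
    (lZ _ A0) (lZ _ B0); clear; lra.
Qed.

(** If cL is small then L is nearly a right angle and R is nearly 0: the step almost swaps
    the two rows, so that it carries the entries kj and jk to the diagonal, and the
    old diagonal, which takes their place, must be small already.  The tangents of the
    deviations of L and R are about kk / jk and jj / jk when jk dominates kj, so that
    |sR| <= cL bounds the entry jj by the entry kk. *)
Lemma svd_small_angle (R : realType) (u v : svd_state R) (cL sL cR sR : R) :
  svd_step u v cL sL cR sR -> cL <= 1 / 100 ->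
  let E := `|e_jk u| + `|e_kj u| in
  [/\ `|sR| <= 1 / 100,
      [/\ `|e_jj u| + `|e_kk u| <= 3 / 100 * E, `|e_kj u| <= 11 / 10 * `|e_kk v| + 1 / 100 * E &
       `|e_jk u| <= 11 / 10 * `|e_ll v| + 1 / 100 * E],
      `|e_kk v| <= 2 * `|e_kj u| + `|e_jj u| / 20,
      `|e_kk v| <= `|e_kj u| + 1 / 100 * E &
      `|e_kj u| <= `|e_jk u| / 4 -> `|e_jj u| <= 2 * `|e_kk u|].
Proof.
case: u v => [X Y m n a b t] [X' Y' m' n' a' b' t'].
move=> [/= uL uR leL leR _ _ _ _ _ _ Hb Ht Hm Hn] cL1.
have r0 : 0 <= `|sR| by apply: normr_ge0.
have l0 : 0 <= cL by apply: le_trans leL.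
have cR0 : 0 <= cR by apply: le_trans leR.
have r1 : `|sR| <= 1 / 100 by apply: le_trans leL _.
have sR2 : sR ^+ 2 <= (1 / 100) ^+ 2.
  by rewrite -[sR ^+ 2]real_normK ?num_real // lerXn2r ?nnegrE //; lra.
have cL2 : cL ^+ 2 <= (1 / 100) ^+ 2.
  by rewrite lerXn2r ?nnegrE //; lra.
have cR1 : 99 / 100 <= cR.
  by rewrite -(@ler_pXn2r _ 2) ?nnegrE //; [move: uR sR2; clear; lra | lra].
have cR2 : cR <= 1.
  by rewrite -(@ler_pXn2r _ 2) ?nnegrE //; move: uR (sqr_ge0 sR); clear; lra.
have sL1 : 99 / 100 <= `|sL|.
  rewrite -(@ler_pXn2r _ 2) ?nnegrE ?real_normK ?num_real //; last lra.
  by move: uL cL2; clear; lra.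
have sL2 : `|sL| <= 1.
  rewrite -(@ler_pXn2r _ 2) ?nnegrE ?real_normK ?num_real //.
  by move: uL (sqr_ge0 cL); clear; lra.
have big Z : 98 / 100 * `|Z| <= `|sL * cR * Z| <= `|Z|.
  rewrite normrM normrM (ger0_norm cR0); apply/andP; split.
    apply: ler_wpM2r => //; apply: (@le_trans _ _ (99 / 100 * (99 / 100))); first lra.
    by apply: ler_pM => //; lra.
  rewrite ler_piMl // mulr_ile1 //.
have mid Z : 98 / 100 * (cL * `|Z|) <= `|cL * cR * Z| <= cL * `|Z|.
  rewrite normrM normrM (ger0_norm cR0) (ger0_norm l0); apply/andP; split.
    by rewrite [leRHS]mulrAC [leRHS]mulrC ler_wpM2r ?mulr_ge0 //; lra.
  by rewrite -mulrA ler_wpM2l // ler_piMl.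
have mid' Z : 98 / 100 * (`|sR| * `|Z|) <= `|sL * sR * Z| <= `|sR| * `|Z|.
  rewrite normrM normrM; apply/andP; split.
    by rewrite -[leRHS]mulrA ler_wpM2r ?mulr_ge0 //; lra.
  by rewrite -mulrA ler_piMl ?mulr_ge0.
have low Z : `|cL * sR * Z| = cL * (`|sR| * `|Z|).
  by rewrite !normrM (ger0_norm l0) mulrA.
have [/andP[ga ga'] /andP[gb gb'] /andP[gm gm'] /andP[gn gn']] := And4 (big a) (big b) (big m) (big n).
have [/andP[ha ha'] /andP[hb hb'] /andP[hm hm'] /andP[hn hn']] := And4 (mid a) (mid b) (mid m) (mid n).
have [/andP[ka ka'] /andP[kb kb'] /andP[km km'] /andP[kn kn']] := And4 (mid' a) (mid' b) (mid' m) (mid' n).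
have tri3 (x y z : R) : `|x + y + z| <= `|x| + `|y| + `|z|.
  by rewrite (le_trans (ler_normD _ _)) // lerD2r ler_normD.
have tri4 (x y z w : R) : `|x + y + z + w| <= `|x| + `|y| + `|z| + `|w|.
  by rewrite (le_trans (ler_normD _ _)) // lerD2r tri3.
have Eb : sL * cR * b = sL * sR * n + cL * sR * a - cL * cR * m by move: Hm; clear; lra.
have Ea : sL * cR * a = cL * cR * n + cL * sR * b - sL * sR * m by move: Hn; clear; lra.
have En : sL * cR * n = b' - cL * cR * a - cL * sR * m - sL * sR * b by move: Hb; clear; lra.
have Em : sL * cR * m = - t' + sL * sR * a - cL * sR * n + cL * cR * b by move: Ht; clear; lra.
apply: (@svd_small_angle_bounds _ cL `|sR|) => //.
- have := tri3 (sL * sR * n) (cL * sR * a) (- (cL * cR * m)).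
  by rewrite -Eb normrN low; move: gb kn' hm'; clear; lra.
- have := tri3 (cL * cR * n) (cL * sR * b) (- (sL * sR * m)).
  by rewrite -Ea normrN low; move: ga hn' km'; clear; lra.
- have := tri3 (sL * sR * n) (cL * sR * a) (- (sL * cR * b)).
  rewrite (_ : sL * sR * n + cL * sR * a - sL * cR * b = cL * cR * m); last by rewrite Eb; ring.
  by rewrite normrN low; move: hm kn' gb'; clear; lra.
- have := tri3 (cL * cR * n) (cL * sR * b) (- (sL * cR * a)).
  rewrite (_ : cL * cR * n + cL * sR * b - sL * cR * a = sL * sR * m); last by rewrite Ea; ring.
  by rewrite normrN low; move: km hn' ga'; clear; lra.
- have := tri4 b' (- (cL * cR * a)) (- (cL * sR * m)) (- (sL * sR * b)).
  by rewrite -En !normrN low; move: gn ha' kb'; clear; lra.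
- have := tri4 (- t') (sL * sR * a) (- (cL * sR * n)) (cL * cR * b).
  by rewrite -Em !normrN low; move: gm ka' hb'; clear; lra.
- have := tri4 (cL * cR * a) (cL * sR * m) (sL * cR * n) (sL * sR * b).
  by rewrite -Hb low; move: ha' gn' kb'; clear; lra.
Qed.

(** The entry lj, which becomes kj one step later, is multiplied by sR. *)
Lemma svd_kj_decay (R : realType) (u v w : svd_state R)
    (cL sL cR sR cL' sL' cR' sR' : R) :
  svd_step u v cL sL cR sR -> svd_step v w cL' sL' cR' sR' ->
  `|sR| <= 1 / 100 -> `|e_kj w| <= 1 / 50 * `|e_kj v|.
Proof.
move=> Hu Hv r1.
rewrite (svd_kj Hv) (svd_kj Hu) (svd_lj Hu) !normrM normrN.
have uR := svd_unitR Hu; have uR' := svd_unitR Hv.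
have cR0 : 0 <= cR := le_trans (normr_ge0 _) (svd_leR Hu).
have cR0' : 0 <= cR' := le_trans (normr_ge0 _) (svd_leR Hv).
have sR2 : sR ^+ 2 <= (1 / 100) ^+ 2.
  by rewrite -[sR ^+ 2]real_normK ?num_real // lerXn2r ?nnegrE //; lra.
have cR1 : 1 / 2 <= cR.
  by rewrite -(@ler_pXn2r _ 2) ?nnegrE //; [move: uR sR2; clear; lra | lra].
have cR2 : cR' <= 1.
  by rewrite -(@ler_pXn2r _ 2) ?nnegrE //; move: uR' (sqr_ge0 sR'); clear; lra.
rewrite !mulrA ler_wpM2r // (ger0_norm cR0) (ger0_norm cR0').
apply: (@le_trans _ _ (1 * (1 / 100))); first by apply: ler_pM.
by move: cR1; clear; lra.
Qed.

(** Write m and n for the entries jk and kj.  A step moves n to the entry kk of the next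
    state, and m to ll, hence to jj two states later, where the diagonal is small
    with respect to m and n: so m and n grow fast, while n cannot grow by
    [svd_kj_decay].  Hence |n| <= |m| in state 1 or 2.  From such a state, the entry jj
    two steps later is about m; it is bounded by the entry kk of that state, which
    is about the n of the state between.  That one is much smaller than |m|, so
    m = n = 0, and the step is trivial, contrary to cL being small. *)
Lemma svd_cascade (R : realType) (u : nat -> svd_state R) (cL sL cR sR : nat -> R) :
  (forall k, (k < 5)%N ->
     svd_step (u k) (u k.+1) (cL k) (sL k) (cR k) (sR k) /\ cL k <= 1 / 100) ->
  False.
Proof.
move=> H.
have est k (k5 : (k < 5)%N) := svd_small_angle (H k k5).1 (H k k5).2.
have decay k : (k < 4)%N -> `|e_kj (u k.+2)| <= 1 / 50 * `|e_kj (u k.+1)|.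
  move=> k4; have k5 : (k < 5)%N by apply: ltn_trans k4 _.
  apply: svd_kj_decay (H k k5).1 (H k.+1 k4).1 _.
  by case: (est k k5).
have aE k : (k < 4)%N -> e_jj (u k.+2) = e_ll (u k.+1).
  by move=> k4; rewrite (svd_jj (H k.+1 k4).1).
have nz k : (k < 5)%N -> e_jk (u k) = 0 -> e_kj (u k) = 0 -> False.
  move=> k5 m0 n0; case: (H k k5) => /svd_trivial /(_ m0 n0)[-> _].
  by lra.
have key j : (0 < j < 3)%N -> `|e_kj (u j)| <= `|e_jk (u j)| -> False.
  case: j => // i /=; rewrite ltnS => i2 nm.
  have i5 : (i.+1 < 5)%N by apply: leq_ltn_trans i2 _.
  have i5' : (i.+2 < 5)%N by apply: (@leq_ltn_trans 3).
  have i5'' : (i.+3 < 5)%N by apply: (@leq_ltn_trans 4).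
  have m0 : e_jk (u i.+1) = 0.
    apply/normr0_eq0/eqP; rewrite eq_le normr_ge0 andbT.
    have [_ [_ _ mt] _ b1 _] := est _ i5.
    have [_ [ab1 _ _] b2 _ a2] := est _ i5'.
    have [_ [ab2 _ _] _ _ a3] := est _ i5''.
    have d1 : `|e_kj (u i.+2)| <= 1 / 50 * `|e_kj (u i.+1)| by apply: decay; apply: leq_trans i2 _.
    have d2 : `|e_kj (u i.+3)| <= 1 / 50 * `|e_kj (u i.+2)| by apply: decay.
    rewrite -aE in mt; last by [].
    have a3' : `|e_jj (u i.+3)| <= 2 * `|e_kk (u i.+3)|.
      apply: a3; move: mt nm ab2 d1 d2 (normr_ge0 (e_kk (u i.+3))).
      by move: (normr_ge0 (e_jk (u i.+3))) (normr_ge0 (e_kj (u i.+3))); clear; lra.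
    (* The entry jj of the state between enters the bound on kk, with factor 1 / 20. *)
    case: (lerP `|e_kj (u i.+2)| (`|e_jk (u i.+2)| / 4)) => [/a2 a2'|gt_nm].
      by move: mt nm d1 a3' b2 a2' b1; clear; lra.
    move: mt nm d1 a3' b2 ab1 gt_nm (normr_ge0 (e_kk (u i.+2))); clear; lra.
  apply: (nz i.+1 i5 m0); apply/normr0_eq0/eqP.
  by rewrite eq_le normr_ge0 andbT (le_trans nm) // m0 normr0.
(* If n dominates m in state 1, then m is much larger than both in state 2. *)
case: (lerP `|e_kj (u 1%N)| `|e_jk (u 1%N)|) => [|gt_nm]; first exact: key.
apply: (key 2%N) => //.
have [_ [_ n1 _] _ _ _] := est 1%N isT.
have [_ [ab2 _ _] _ _ _] := est 2%N isT.
have d1 := decay 0%N isT.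
by move: gt_nm n1 ab2 d1 (normr_ge0 (e_jj (u 2%N))) (normr_ge0 (e_jk (u 2%N))); clear; lra.
Qed.

(** The next entry jk is cL times the entry jl, and the next jl is - sL times it: while the
    entries jk remain small, jl keeps its size and every cL is small. *)
Lemma svd_no_stall_jl (R : realType) (u : nat -> svd_state R) (cL sL cR sR : nat -> R) :
  (forall k, (k < 5)%N -> svd_step (u k) (u k.+1) (cL k) (sL k) (cR k) (sR k)) ->
  e_jl (u 0%N) != 0 ->
  (forall k, (k < 5)%N -> `|e_jk (u k.+1)| <= `|e_jl (u 0%N)| / 200) -> False.
Proof.
move=> H x0 small.
have x0p : 0 < e_jl (u 0%N) ^+ 2 by rewrite exprn_even_gt0.
have xk k : (k <= 5)%N -> (1 - k%:R / 100) * e_jl (u 0%N) ^+ 2 <= e_jl (u k) ^+ 2.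
  elim: k => [|k IH] k5; first by rewrite mul0r subr0 mul1r.
  have Hk := H k k5; have := IH (ltnW k5); have uL := svd_unitL Hk.
  have : e_jk (u k.+1) ^+ 2 <= (e_jl (u 0%N) / 200) ^+ 2.
    rewrite -[X in X <= _]real_normK ?num_real // -[leRHS]real_normK ?num_real //.
    by rewrite lerXn2r ?nnegrE // normrM normfV normr_nat small.
  rewrite (svd_jl Hk) (svd_jk Hk) -[k.+1%:R]natr1.
  have -> : (- sL k * e_jl (u k)) ^+ 2 = e_jl (u k) ^+ 2 - (cL k * e_jl (u k)) ^+ 2.
    by rewrite !exprMn sqrrN -[sL k ^+ 2](addKr (cL k ^+ 2)) uL; ring.
  rewrite (_ : (_ / 200) ^+ 2 = e_jl (u 0%N) ^+ 2 / 200 / 200); last by field.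
  by move: x0p; clear; lra.
apply: (@svd_cascade _ u cL sL cR sR) => k k5; split; first exact: H.
have := small k k5; have Hk := H k k5; rewrite (svd_jk Hk) normrM.
have cL0 : 0 <= cL k := le_trans (normr_ge0 _) (svd_leL Hk).
rewrite (ger0_norm cL0).
have xbig : `|e_jl (u 0%N)| / 2 <= `|e_jl (u k)|.
  rewrite -(@ler_pXn2r _ 2) ?nnegrE ?divr_ge0 // expr_div_n !real_normK ?num_real //.
  apply: le_trans (xk k (ltnW k5)).
  have : k%:R <= 5 :> R by rewrite ler_nat ltnW.
  move=> k5'; rewrite [leLHS]mulrC ler_wpM2r ?ltW //; lra.
have xp : 0 < `|e_jl (u 0%N)| by rewrite normr_gt0.
move=> Hs.
have : cL k * (`|e_jl (u 0%N)| / 2) <= `|e_jl (u 0%N)| / 200.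
  by apply: le_trans Hs; rewrite ler_wpM2l.
rewrite mulrCA -[X in _ <= X -> _]mulr1 -!mulrA ler_pM2l // => Hc; lra.
Qed.

Definition svd_tr (R : realType) (u : svd_state R) : svd_state R :=
  SvdState (e_lj u) (e_jl u) (e_kj u) (e_jk u) (e_jj u) (e_kk u) (e_ll u).

Lemma svd_step_tr (R : realType) (u v : svd_state R) (cL sL cR sR : R) :
  svd_step u v cL sL cR sR -> svd_step (svd_tr u) (svd_tr v) cR sR cL sL.
Proof.
case=> *; split => //=.
- by move=> *; apply/and_comm; auto.
all: lra.
Qed.

(** Transposing the whole trajectory if needed, the larger of the two entries is jl. *)
Lemma svd_no_stall (R : realType) (u : nat -> svd_state R) (cL sL cR sR : nat -> R) :
  (forall k, (k < 5)%N -> svd_step (u k) (u k.+1) (cL k) (sL k) (cR k) (sR k)) ->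
  0 < e_jl (u 0%N) ^+ 2 + e_lj (u 0%N) ^+ 2 ->
  (forall k, (k < 5)%N ->
     (200 * e_jk (u k.+1)) ^+ 2 <= (e_jl (u 0%N) ^+ 2 + e_lj (u 0%N) ^+ 2) / 2 /\
     (200 * e_kj (u k.+1)) ^+ 2 <= (e_jl (u 0%N) ^+ 2 + e_lj (u 0%N) ^+ 2) / 2) ->
  False.
Proof.
move=> H pos small.
have bound (x z w : R) : (200 * z) ^+ 2 <= w / 2 -> w / 2 <= x ^+ 2 -> `|z| <= `|x| / 200.
  move=> zw wx; rewrite ler_pdivlMr // mulrC.
  rewrite -(@ler_pXn2r _ 2) ?nnegrE ?mulr_ge0 //.
  rewrite exprMn !real_normK ?num_real // -exprMn; exact: le_trans wx.
case: (lerP (e_lj (u 0%N) ^+ 2) (e_jl (u 0%N) ^+ 2)) => xy.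
  apply: (svd_no_stall_jl H).
    rewrite -sqrf_eq0 gt_eqF //; by move: xy pos (sqr_ge0 (e_lj (u 0%N))); clear; lra.
  by move=> k /small[+ _] => /bound; apply; lra.
apply: (@svd_no_stall_jl _ (fun k => svd_tr (u k)) cR sR cL sL).
- by move=> k k5; apply/svd_step_tr/H.
- rewrite /= -sqrf_eq0 gt_eqF //; by move: xy (sqr_ge0 (e_jl (u 0%N))); clear; lra.
- by move=> k /small[_ +] => /bound; apply => /=; lra.
Qed.

(** * Two opposite pivots as one singular value step *)

(** Two successive Jacobi steps with disjoint pivots pq and rt, in a form that does
    not depend on which of them comes first. *)
Record block_step (R : realType) (n : nat) (A B : 'M[R]_n) (p q r t : 'I_n)
    (c s c' s' : R) : Prop := BlockStep {
  block_unit : c ^+ 2 + s ^+ 2 = 1 /\ c' ^+ 2 + s' ^+ 2 = 1;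
  block_angle : `|s| <= c /\ `|s'| <= c';
  block_trivial : (A p q = 0 -> s = 0) /\ (A r t = 0 -> s' = 0);
  block_tan : (c ^+ 2 - s ^+ 2) * A p q = c * s * (A p p - A q q) /\
              (c' ^+ 2 - s' ^+ 2) * A r t = c' * s' * (A r r - A t t);
  block_sym : B^T = B;
  block_pivot : B p q = 0 /\ B r t = 0;
  block_pr : B p r = c * c' * A p r + c * s' * A p t + s * c' * A q r + s * s' * A q t;
  block_pt : B p t = c * c' * A p t - c * s' * A p r + s * c' * A q t - s * s' * A q r;
  block_qr : B q r = c * c' * A q r + c * s' * A q t - s * c' * A p r - s * s' * A p t;
  block_qt : B q t = c * c' * A q t - c * s' * A q r - s * c' * A p t + s * s' * A p r;
  block_pp : B p p = c ^+ 2 * A p p + 2 * c * s * A p q + s ^+ 2 * A q q;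
  block_qq : B q q = s ^+ 2 * A p p - 2 * c * s * A p q + c ^+ 2 * A q q;
  block_rr : B r r = c' ^+ 2 * A r r + 2 * c' * s' * A r t + s' ^+ 2 * A t t;
  block_tt : B t t = s' ^+ 2 * A r r - 2 * c' * s' * A r t + c' ^+ 2 * A t t }.

Lemma block_step_swap (R : realType) (n : nat) (A B : 'M[R]_n) (p q r t : 'I_n)
    (c s c' s' : R) :
  A^T = A -> block_step A B p q r t c s c' s' -> block_step A B r t p q c' s' c s.
Proof.
move=> symA [[u1 u2] [g1 g2] [tr1 tr2] [tan1 tan2] symB [p1 p2] pr pt qr qt pp qq rr tt].
have symAE i j : A i j = A j i by rewrite -[in LHS]symA mxE.
have symBE i j : B i j = B j i by rewrite -[in LHS]symB mxE.
split=> //.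
- by rewrite symBE pr !(symAE r) !(symAE t); ring.
- by rewrite symBE qr !(symAE r) !(symAE t); ring.
- by rewrite symBE pt !(symAE r) !(symAE t); ring.
- by rewrite symBE qt !(symAE r) !(symAE t); ring.
Qed.

Lemma jacobi_step_block (R : realType) (n : nat) (A A1 B : 'M[R]_n) (p q r t : 'I_n)
    (c s c' s' : R) :
  uniq [:: p; q; r; t] -> A^T = A ->
  jacobi_step A A1 p q c s -> jacobi_step A1 B r t c' s' ->
  block_step A B p q r t c s c' s'.
Proof.
rewrite /= !inE !negb_or => /and4P[/and3P[pq pr pt] /andP[qr qt] rt _] symA HA HB.
have [qp rp tp] : [/\ q != p, r != p & t != p] by rewrite ![_ == p]eq_sym.
have [rq tq tr] : [/\ r != q, t != q & t != r] by rewrite ![_ == q]eq_sym [t == r]eq_sym.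
have symE (M : 'M[R]_n) : M^T = M -> forall i j, M i j = M j i.
  by move=> symM i j; rewrite -[in LHS]symM mxE.
have symAE := symE _ symA; have symA1E := symE _ (step_sym HA).
have symBE := symE _ (step_sym HB).
have restA := step_rest HA; have restB := step_rest HB.
split.
- by split; [exact: step_unit HA | exact: step_unit HB].
- by split; [exact: step_angle HA | exact: step_angle HB].
- split; first exact: step_trivial HA.
  by move=> rt0; apply: (step_trivial HB); rewrite restA.
- split; first exact: step_tan HA.
  by have := step_tan HB; rewrite !restA.
- exact: step_sym HB.
- by split; [rewrite restB //; exact: step_pivot HA | exact: step_pivot HB].
- rewrite symBE (step_p HB) // ![A1 _ p]symA1E !(step_p HA) //; ring.
- rewrite symBE (step_q HB) // ![A1 _ p]symA1E !(step_p HA) //; ring.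
- rewrite symBE (step_p HB) // ![A1 _ q]symA1E !(step_q HA) //; ring.
- rewrite symBE (step_q HB) // ![A1 _ q]symA1E !(step_q HA) //; ring.
- by rewrite restB // (step_pp HA).
- by rewrite restB // (step_qq HA).
- by rewrite (step_pp HB) !restA.
- by rewrite (step_qq HB) !restA.
Qed.

Lemma jacobi_step_block_orders (R : realType) (n : nat) (A A1 B : 'M[R]_n)
    (p q r t : 'I_n) (c s c' s' : R) :
  uniq [:: p; q; r; t] -> A^T = A ->
  jacobi_step A A1 p q c s -> jacobi_step A1 B r t c' s' ->
  [/\ block_step A B p q r t c s c' s', block_step A B p q t r c s c' (- s'),
      block_step A B r t p q c' s' c s & block_step A B r t q p c' s' c (- s)].
Proof.
move=> pqrt symA HA HB.
have b1 := jacobi_step_block pqrt symA HA HB.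
split=> //; last 2 first.
- exact: block_step_swap.
- apply: block_step_swap => //.
  apply: jacobi_step_block (jacobi_step_swap symA HA) HB => //.
  by move: pqrt; rewrite /= !inE !negb_or (eq_sym q p)
    => /and4P[/and3P[-> -> ->] /andP[-> ->] ->].
apply: jacobi_step_block HA (jacobi_step_swap (step_sym HA) HB) => //.
by move: pqrt; rewrite /= !inE !negb_or (eq_sym t r)
  => /and4P[/and3P[-> -> ->] /andP[-> ->] ->].
Qed.

(** Up to scalar matrices, A corresponds to the 3 x 3 matrix T such that the value of the
    quadratic form A at a unit quaternion q (with basis o, j, l, k) is the inner product
    of T with the rotation matrix of q. *)
Definition svd_of (R : realType) (A : 'M[R]_4) (o j l k : 'I_4) : svd_state R :=
  SvdState ((A j l - A o k) / 2) ((A j l + A o k) / 2)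
    ((A j k + A o l) / 2) ((A j k - A o l) / 2)
    ((A o o + A j j - A l l - A k k) / 4) ((A o o + A k k - A j j - A l l) / 4)
    ((A o o + A l l - A j j - A k k) / 4).

Lemma unit_circle_sin0 (R : realType) (c s : R) :
  `|s| <= c -> c ^+ 2 + s ^+ 2 = 1 -> s = 0 -> c = 1.
Proof.
move=> sc + s0; rewrite s0 expr0n addr0 => /eqP; rewrite sqrf_eq1 => /orP[/eqP //|/eqP c1].
by move: sc; rewrite c1 s0 normr0; lra.
Qed.

(** The rotations of the planes ol and jk, by angles phi and psi, act on T as rotations
    of the rows by psi - phi and of the columns by psi + phi.  The equations jk and kj
    of the singular value step are half the sum and half the difference
    of the equations of the two Jacobi angles. *)
Lemma block_svd_step (R : realType) (A B : 'M[R]_4) (o j l k : 'I_4) (c s c' s' : R) :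
  A^T = A -> A l k = 0 -> A o j = 0 ->
  block_step A B o l j k c s c' s' ->
  svd_step (svd_of A o j l k) (svd_tr (svd_of B o l k j))
    (c * c' + s * s') (c * s' - s * c') (c * c' - s * s') (c * s' + s * c').
Proof.
move=> symA lk0 oj0 [[u1 u2] [g1 g2] [tr1 tr2] [tan1 tan2] symB [p1 p2] pr pt qr qt pp qq rr tt].
have symAE i i' : A i i' = A i' i by rewrite -[in LHS]symA mxE.
have symBE i i' : B i i' = B i' i by rewrite -[in LHS]symB mxE.
have diff1 : B o o - B l l = (c ^+ 2 - s ^+ 2) * (A o o - A l l) + 4 * c * s * A o l.
  by rewrite pp qq; ring.
have diff2 : B j j - B k k = (c' ^+ 2 - s' ^+ 2) * (A j j - A k k) + 4 * c' * s' * A j k.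
  by rewrite rr tt; ring.
have sum1 : B o o + B l l = A o o + A l l.
  by transitivity ((c ^+ 2 + s ^+ 2) * (A o o + A l l)); [rewrite pp qq; ring | rewrite u1 mul1r].
have sum2 : B j j + B k k = A j j + A k k.
  by transitivity ((c' ^+ 2 + s' ^+ 2) * (A j j + A k k)); [rewrite rr tt; ring | rewrite u2 mul1r].
have diff1' : B o o - B l l = (c' ^+ 2 + s' ^+ 2) *
    ((c ^+ 2 - s ^+ 2) * (A o o - A l l) + 4 * c * s * A o l) by rewrite diff1 u2 mul1r.
have diff2' : B j j - B k k = (c ^+ 2 + s ^+ 2) *
    ((c' ^+ 2 - s' ^+ 2) * (A j j - A k k) + 4 * c' * s' * A j k) by rewrite diff2 u1 mul1r.
have tan1' : (c' ^+ 2 + s' ^+ 2) * ((c ^+ 2 - s ^+ 2) * A o l) =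
    (c' ^+ 2 + s' ^+ 2) * (c * s * (A o o - A l l)) by rewrite tan1.
have tan2' : (c ^+ 2 + s ^+ 2) * ((c' ^+ 2 - s' ^+ 2) * A j k) =
    (c ^+ 2 + s ^+ 2) * (c' * s' * (A j j - A k k)) by rewrite tan2.
have [s1 s2] : - c <= s <= c /\ - c' <= s' <= c' by rewrite -!ler_norml.
have [/andP[s11 s12] /andP[s21 s22]] := conj s1 s2.
have pos1 : 0 <= (c - s) * (c' - s') by apply: mulr_ge0; lra.
have pos2 : 0 <= (c + s) * (c' + s') by apply: mulr_ge0; lra.
have pos3 : 0 <= (c - s) * (c' + s') by apply: mulr_ge0; lra.
have pos4 : 0 <= (c + s) * (c' - s') by apply: mulr_ge0; lra.
have lj : A l j = A j l := symAE l j.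
rewrite lk0 oj0 lj in pr pt qr qt.
split => /=.
- transitivity ((c ^+ 2 + s ^+ 2) * (c' ^+ 2 + s' ^+ 2)); [ring | by rewrite u1 u2 mulr1].
- transitivity ((c ^+ 2 + s ^+ 2) * (c' ^+ 2 + s' ^+ 2)); [ring | by rewrite u1 u2 mulr1].
- by rewrite ler_norml; move: pos1 pos2; clear; lra.
- by rewrite ler_norml; move: pos3 pos4; clear; lra.
- move=> m0 n0; have ol0 : A o l = 0 by lra.
  have jk0 : A j k = 0 by lra.
  have s0 := tr1 ol0; have s0' := tr2 jk0.
  by rewrite s0 s0' (unit_circle_sin0 g1 u1 s0) (unit_circle_sin0 g2 u2 s0'); split; ring.
- by rewrite qt pr; field.
- by rewrite qt pr; field.
- by rewrite qr pt; field.
- by rewrite qr pt; field.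
- by rewrite sum1; move: sum2; clear; lra.
- transitivity (((B o o - B l l) + (B j j - B k k)) / 4); first by field.
  by rewrite diff1' diff2'; field.
- transitivity (((B o o - B l l) - (B j j - B k k)) / 4); first by field.
  by rewrite diff1' diff2'; field.
- by move: tan1' tan2'; clear; lra.
- by move: tan1' tan2'; clear; lra.
Qed.

(** The block numbered n has pivots (o, lab (n + 1)) and (lab n, lab (n + 2)), and W is at
    most the squared off-norm of B 1.  Every other state is transposed, since a singular
    value step ends with a transposition. *)
Lemma parallel_no_stall (R : realType) (B : nat -> 'M[R]_4) (o : 'I_4) (lab : nat -> 'I_4)
    (W : R) :
  (forall n, lab n.+3 = lab n) ->
  (forall n, (n < 6)%N ->
     exists c s c' s',
       block_step (B n) (B n.+1) o (lab n.+1) (lab n) (lab n.+2) c s c' s') ->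
  (forall n, (0 < n < 7)%N ->
     (600 * B n o (lab n.+1)) ^+ 2 <= W /\ (600 * B n (lab n) (lab n.+2)) ^+ 2 <= W) ->
  W <= B 1%N o (lab 2) ^+ 2 + B 1%N (lab 1) (lab 3) ^+ 2 +
       B 1%N o (lab 3) ^+ 2 + B 1%N (lab 1) (lab 2) ^+ 2 ->
  W <= 0.
Proof.
move=> lab3 steps small WE; rewrite leNgt; apply/negP => W0.
have symB n : (n < 6)%N -> (B n.+1)^T = B n.+1.
  by move=> n6; have [c [s [c' [s' /block_sym]]]] := steps n n6.
pose u n := svd_of (B n.+1) o (lab n.+1) (lab n.+2) (lab n.+3).
pose v n := if odd n then svd_tr (u n) else u n.
have trK (x : svd_state R) : svd_tr (svd_tr x) = x by case: x.
have ustep k : (k < 5)%N -> exists cL sL cR sR, svd_step (u k) (svd_tr (u k.+1)) cL sL cR sR.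
  move=> k5; have k6 : (k < 6)%N := ltnW k5.
  have [c [s [c' [s' /block_pivot[p1 p2]]]]] := steps k k6.
  have [d [t [d' [t' Hb]]]] := steps k.+1 k5.
  have Hk := block_svd_step (symB k k6) _ _ Hb.
  do 4!eexists; rewrite /u (lab3 k.+1); apply: Hk => //.
  by rewrite lab3 -(symB k k6) mxE.
have vstep k : (k < 5)%N -> exists cs : R * R * R * R,
    svd_step (v k) (v k.+1) cs.1.1.1 cs.1.1.2 cs.1.2 cs.2.
  move=> /ustep[cL [sL [cR [sR Hk]]]]; rewrite /v /=; case: (odd k) => /=.
    by exists (cR, sR, cL, sL); have := svd_step_tr Hk; rewrite trK.
  by exists (cL, sL, cR, sR).
have [cs Hcs] : exists cs : nat -> R * R * R * R, forall k, (k < 5)%N ->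
    svd_step (v k) (v k.+1) (cs k).1.1.1 (cs k).1.1.2 (cs k).1.2 (cs k).2.
  have [cs0 H0] := vstep 0%N isT; have [cs1 H1] := vstep 1%N isT.
  have [cs2 H2] := vstep 2%N isT; have [cs3 H3] := vstep 3%N isT.
  have [cs4 H4] := vstep 4%N isT.
  exists (nth cs0 [:: cs0; cs1; cs2; cs3; cs4]).
  by do 5!case=> //.
pose x0 := B 1%N (lab 1) (lab 2); pose y0 := B 1%N o (lab 3).
have xy0 : e_jl (v 0%N) ^+ 2 + e_lj (v 0%N) ^+ 2 = (x0 ^+ 2 + y0 ^+ 2) / 2.
  by rewrite /v /u /= -/x0 -/y0; field.
have sq600 (z : R) : (600 * z) ^+ 2 <= W -> z ^+ 2 <= W / 600 / 600.
  by rewrite exprMn !ler_pdivlMr ?ltr0n // => ?; rewrite -mulrA mulrC -expr2.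
have big : W / 2 <= x0 ^+ 2 + y0 ^+ 2.
  have [/sq600 p1 /sq600 p2] := small 1%N isT.
  by move: WE p1 p2 W0; rewrite -/x0 -/y0; clear; lra.
have mean (p q : R) : p ^+ 2 <= W / 600 / 600 -> q ^+ 2 <= W / 600 / 600 ->
    (200 * ((p + q) / 2)) ^+ 2 <= (x0 ^+ 2 + y0 ^+ 2) / 2 / 2.
  move=> p2 q2.
  have -> : (200 * ((p + q) / 2)) ^+ 2 = 100 * 100 * (2 * p ^+ 2 + 2 * q ^+ 2) - (100 * (p - q)) ^+ 2.
    by field.
  by move: p2 q2 big W0 (sqr_ge0 (100 * (p - q))); clear; lra.
refine (@svd_no_stall _ v (fun k => (cs k).1.1.1) (fun k => (cs k).1.1.2)
          (fun k => (cs k).1.2) (fun k => (cs k).2) Hcs _ _).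
- by rewrite xy0; move: big W0; clear; lra.
- move=> k k5; rewrite xy0.
  have [/sq600 p1 /sq600 p2] := small k.+2 k5.
  have mn : (200 * e_jk (u k.+1)) ^+ 2 <= (x0 ^+ 2 + y0 ^+ 2) / 2 / 2 /\
            (200 * e_kj (u k.+1)) ^+ 2 <= (x0 ^+ 2 + y0 ^+ 2) / 2 / 2.
    split; rewrite /u /=; first exact: mean.
    by apply: mean; rewrite ?sqrrN.
  by rewrite /v; case: (odd _) => //=; case: mn.
Qed.

(** * Parallel orderings *)

(** The index paired with 0 by the perfect matching that contains the pivot e. *)
Definition axis (e : nat) : 'I_4 :=
  let i1 := @Ordinal 4 1 isT in let i2 := @Ordinal 4 2 isT in let i3 := @Ordinal 4 3 isT in
  nth ord0 [:: i1; i2; i3; i3; i2; i1] e.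

Lemma ord4_cases (j : 'I_4) :
  [|| j == @Ordinal 4 0 isT, j == @Ordinal 4 1 isT, j == @Ordinal 4 2 isT
    | j == @Ordinal 4 3 isT].
Proof. by case: j => [[|[|[|[|j]]]] j4]. Qed.

Lemma opposite_block (R : realType) (A A1 B : 'M[R]_4) (e : nat) (j k : 'I_4) (c s c' s' : R) :
  (e < 6)%N -> uniq [:: ord0; axis e; j; k] -> A^T = A ->
  jacobi_step A A1 (edge e).1 (edge e).2 c s ->
  jacobi_step A1 B (edge (5 - e)).1 (edge (5 - e)).2 c' s' ->
  (exists c s c' s', block_step A B ord0 (axis e) j k c s c' s') /\
  forall W, (600 * A (edge e).1 (edge e).2) ^+ 2 <= W ->
    (600 * A1 (edge (5 - e)).1 (edge (5 - e)).2) ^+ 2 <= W ->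
    (600 * A ord0 (axis e)) ^+ 2 <= W /\ (600 * A j k) ^+ 2 <= W.
Proof.
have o0 : ord0 = @Ordinal 4 0 isT by apply: val_inj.
rewrite o0 => e6 uq symA HA HB.
have symAE i i' : A i i' = A i' i by rewrite -[in LHS]symA mxE.
have A1E : A1 (edge (5 - e)).1 (edge (5 - e)).2 = A (edge (5 - e)).1 (edge (5 - e)).2.
  by apply: (step_rest HA); case: e e6 {uq HA HB} => [|[|[|[|[|[|e]]]]]].
have uqe : uniq [:: (edge e).1; (edge e).2; (edge (5 - e)).1; (edge (5 - e)).2].
  by case: e e6 {uq HA HB A1E} => [|[|[|[|[|[|e]]]]]].
have [b1 b2 b3 b4] := jacobi_step_block_orders uqe symA HA HB.
rewrite A1E; move: uq b1 b2 b3 b4 {uqe HA HB A1E}.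
case: e e6 => [|[|[|[|[|[|e]]]]]] //= _;
  case/or4P: (ord4_cases j) => /eqP -> //=; case/or4P: (ord4_cases k) => /eqP -> //= _ b1 b2 b3 b4;
  split; first [ by do 4!eexists; first [exact: b1 | exact: b2 | exact: b3 | exact: b4]
   | by move=> W H1 H2; split; first [ exact: H1 | exact: H2 | by rewrite symAE ] ].
Qed.

Lemma off_sq_labels (R : realType) (A : 'M[R]_4) (j l k : 'I_4) :
  uniq [:: ord0; j; l; k] -> A^T = A ->
  off_sq (off_vec A) = A ord0 j ^+ 2 + A l k ^+ 2 + A ord0 l ^+ 2 + A j k ^+ 2 +
    A ord0 k ^+ 2 + A j l ^+ 2.
Proof.
have -> : ord0 = @Ordinal 4 0 isT by apply: val_inj.
move=> uq symA; have symAE i i' : A i i' = A i' i by rewrite -[in LHS]symA mxE.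
rewrite /off_sq !big_ord_recl big_ord0 /off_vec /= /edge /=; move: uq.
case/or4P: (ord4_cases j) => /eqP -> //=; case/or4P: (ord4_cases l) => /eqP -> //=;
  case/or4P: (ord4_cases k) => /eqP -> //= _.
all: rewrite ?(symAE (@Ordinal 4 2 isT) (@Ordinal 4 1 isT))
  ?(symAE (@Ordinal 4 3 isT) (@Ordinal 4 1 isT)) ?(symAE (@Ordinal 4 3 isT) (@Ordinal 4 2 isT)).
all: by ring.
Qed.

Lemma ordering_code_lt (es : seq nat) k :
  perm_eq es (iota 0 6) -> (nth 0%N es (k %% 6) < 6)%N.
Proof.
move=> perm_es; have : nth 0%N es (k %% 6) \in es.
  by rewrite mem_nth // (perm_size perm_es) size_iota ltn_mod.
by rewrite (perm_mem perm_es) mem_iota.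
Qed.

Lemma parallel_lossless_eq0 (R : realType) (A : nat -> 'M[R]_4) (es : seq nat)
    (c s : nat -> R) (W : R) :
  perm_eq es (iota 0 6) -> parallel es -> (A 0%N)^T = A 0%N ->
  cyclic_jacobi es A c s ->
  (forall k, (k < 14)%N -> (600 * A k (edge (nth 0%N es (k %% 6))).1
     (edge (nth 0%N es (k %% 6))).2) ^+ 2 <= W) ->
  W <= off_sq (off_vec (A 2%N)) -> W <= 0.
Proof.
case: es => [|e1 [|e1' [|e2 [|e2' [|e3 [|e3' [|? ?]]]]]]] // perm_es /and3P[/eqP E1 /eqP E2 /eqP E3].
have e1E : e1' = (5 - e1)%N by rewrite -E1 addKn.
have e2E : e2' = (5 - e2)%N by rewrite -E2 addKn.
have e3E : e3' = (5 - e3)%N by rewrite -E3 addKn.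
subst e1' e2' e3' => symA0 steps small WE.
have in6 e : e \in [:: e1; 5 - e1; e2; 5 - e2; e3; 5 - e3]%N -> (e < 6)%N.
  by rewrite (perm_mem perm_es) mem_iota.
have e1_6 : (e1 < 6)%N by apply: in6; rewrite !inE eqxx.
have e2_6 : (e2 < 6)%N by apply: in6; rewrite !inE eqxx !orbT.
have e3_6 : (e3 < 6)%N by apply: in6; rewrite !inE eqxx !orbT.
have /and3P[uq1 uq2 uq3] : [&& uniq [:: ord0; axis e1; axis e3; axis e2],
    uniq [:: ord0; axis e2; axis e1; axis e3] & uniq [:: ord0; axis e3; axis e2; axis e1]].
  have : uniq [:: e1; 5 - e1; e2; 5 - e2; e3; 5 - e3]%N by rewrite (perm_uniq perm_es).
  move: e1_6 e2_6 e3_6; clear.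
  case: e1 => [|[|[|[|[|[|e1]]]]]] // _; case: e2 => [|[|[|[|[|[|e2]]]]]] // _;
    by case: e3 => [|[|[|[|[|[|e3]]]]]].
pose lab n := nth ord0 [:: axis e3; axis e1; axis e2] (n %% 3).
have lab3 n : lab n.+3 = lab n by rewrite /lab (_ : n.+3 %% 3 = n %% 3)%N // -addn3 modnDr.
have symA k : (A k)^T = A k by case: k => // k; apply: step_sym (steps k).
have blk e j k m : (e < 6)%N -> uniq [:: ord0; axis e; j; k] -> (m.+1 < 14)%N ->
    nth 0%N [:: e1; 5 - e1; e2; 5 - e2; e3; 5 - e3]%N (m %% 6) = e ->
    nth 0%N [:: e1; 5 - e1; e2; 5 - e2; e3; 5 - e3]%N (m.+1 %% 6) = (5 - e)%N ->
    (exists c s c' s', block_step (A m) (A m.+2) ord0 (axis e) j k c s c' s') /\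
    (600 * A m ord0 (axis e)) ^+ 2 <= W /\ (600 * A m j k) ^+ 2 <= W.
  move=> e6 u m14 Em Em1; have H1 := steps m; have H2 := steps m.+1.
  have S1 := small m (ltnW m14); have S2 := small m.+1 m14.
  rewrite Em in H1 S1; rewrite Em1 in H2 S2.
  by have [X Y] := opposite_block e6 u (symA m) H1 H2; split; [exact: X | exact: Y].
have block n : (n < 7)%N ->
    (exists c s c' s', block_step (A n.*2) (A n.+1.*2) ord0 (lab n.+1) (lab n) (lab n.+2) c s c' s') /\
    (600 * A n.*2 ord0 (lab n.+1)) ^+ 2 <= W /\ (600 * A n.*2 (lab n) (lab n.+2)) ^+ 2 <= W.
  case: n => [|[|[|[|[|[|[|n]]]]]]] // _.
  - exact: (blk e1 _ _ 0%N e1_6 uq1 isT erefl erefl).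
  - exact: (blk e2 _ _ 2%N e2_6 uq2 isT erefl erefl).
  - exact: (blk e3 _ _ 4%N e3_6 uq3 isT erefl erefl).
  - exact: (blk e1 _ _ 6%N e1_6 uq1 isT erefl erefl).
  - exact: (blk e2 _ _ 8%N e2_6 uq2 isT erefl erefl).
  - exact: (blk e3 _ _ 10%N e3_6 uq3 isT erefl erefl).
  - exact: (blk e1 _ _ 12%N e1_6 uq1 isT erefl erefl).
apply: (@parallel_no_stall R (fun n => A n.*2) ord0 lab W lab3).
- by move=> n n6; have [] := block n (ltnW n6).
- by move=> n /andP[_ n7]; have [] := block n n7.
have [[c0 [s0 [c0' [s0' /block_pivot[p1 p2]]]]] _] := block 0%N isT.
have sym2 i j : A 2%N i j = A 2%N j i by rewrite -[in LHS]symA mxE.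
have {}p2 : A 2%N (lab 2) (lab 3) = 0 by rewrite sym2 lab3.
apply: le_trans WE _.
rewrite /= (@off_sq_labels _ _ (lab 2) (lab 1) (lab 3) uq2 (symA 2%N)) p2 p1.
by rewrite (sym2 (lab 2)); lra.
Qed.

(** If less is lost, then all pivots are so small with respect to what remains
    that [parallel_lossless_eq0] applies. *)
Lemma parallel_loss_lower_bound (R : realType) (A : nat -> 'M[R]_4) (es : seq nat)
    (c s : nat -> R) :
  perm_eq es (iota 0 6) -> parallel es -> (A 0%N)^T = A 0%N ->
  cyclic_jacobi es A c s ->
  1 / 700 / 700 * off_sq (off_vec (A 0%N)) <=
    off_sq (off_vec (A 0%N)) - off_sq (off_vec (A 14%N)).
Proof.
move=> perm_es par symA0 steps.
have code6 k := ordering_code_lt k perm_es.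
have symA k : (A k)^T = A k by case: k => // k; apply: step_sym (steps k).
pose S k := off_sq (off_vec (A k)).
have Sstep k := off_sq_jacobi_step (code6 k) (symA k) (steps k).
have mono m n (mn : (m <= n)%N) : S n <= S m.
  exact: (off_sq_nonincreasing symA0 code6 steps mn).
rewrite leNgt -/(S 0%N) -/(S 14%N); apply/negP => small.
have S0 : 0 < S 0%N by have := mono 0%N 14%N isT; move: small; clear; lra.
have W0 : S 2%N <= 0.
  apply: (parallel_lossless_eq0 perm_es par symA0 steps) => // k k14.
  have pivotE : A k (edge (nth 0%N es (k %% 6))).1 (edge (nth 0%N es (k %% 6))).2 ^+ 2 =
      S k - S k.+1 by rewrite [S k.+1]Sstep opprB addrCA subrr addr0.
  have := mono _ _ (leq0n k); have := mono k.+1 14%N k14; have := mono 2%N 14%N isT.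
  by rewrite exprMn pivotE -/(S 2%N); move: small S0; clear; lra.
by have := mono 2%N 14%N isT; move: W0 S0 small; clear; lra.
Qed.

(** * The uniform constant *)

(** If rot 1 es is parallel, then es starts in the middle of a block, and the
    bound for parallel orderings applies from the second step on. *)
Lemma three_sweeps_lossy (R : realType) (es : seq nat) :
  perm_eq es (iota 0 6) ->
  exists2 delta : R, 0 < delta & forall (A : nat -> 'M[R]_4) (c s : nat -> R),
    (A 0%N)^T = A 0%N ->
    cyclic_jacobi es A c s ->
    delta * off_sq (off_vec (A 0%N)) <= off_sq (off_vec (A 0%N)) - off_sq (off_vec (A 18%N)).
Proof.
move=> perm_es; have size_es : size es = 6 by rewrite (perm_size perm_es) size_iota.
have in6 e : e \in es -> (e < 6)%N by rewrite (perm_mem perm_es) mem_iota.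
have code6 k := ordering_code_lt k perm_es.
have := allP cyclic_orders es; rewrite mem_permutations perm_es => /(_ isT).
set es3 := es ++ es ++ es.
have es3_6 : all (gtn 6) es3 by rewrite !all_cat; have -> : all (gtn 6) es by apply/allP => e /in6.
have nth3 k : (k < 18)%N -> nth 0%N es3 k = nth 0%N es (k %% 6).
  by rewrite !nth_cat !size_es; do 18?[case: k => [//|k]].
have size3 : size es3 = 18 by rewrite !size_cat size_es.
case/or3P=> [/eqP dead|par|par].
- have [delta delta0 H] := @loss_lower_bound R es3 es3_6 dead.
  exists delta => // A c s symA steps.
  have csb k : 1 / 2 <= c k <= 1 /\ -1 <= s k <= 1.
    have cs1 := step_unit (steps k); have sc := step_angle (steps k).
    have c0 : 0 <= c k := le_trans (normr_ge0 _) sc.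
    have sc2 : s k ^+ 2 <= c k ^+ 2.
      by rewrite -[s k ^+ 2]real_normK ?num_real // lerXn2r ?nnegrE.
    have c1 : c k <= 1.
      by rewrite -(@ler_pXn2r _ 2) ?nnegrE //; move: cs1 (sqr_ge0 (s k)); clear; lra.
    split; last by rewrite -ler_norml (le_trans sc).
    by rewrite c1 andbT -(@ler_pXn2r _ 2) ?nnegrE //; move: cs1 sc2; clear; lra.
  have := H c s (off_vec (A 0%N)) (fun k => (csb k).1) (fun k => (csb k).2) _.
  rewrite (@loss_jacobi_steps _ A) ?size3 //; last first.
    by move=> k k18; rewrite nth3.
  by apply=> i i6; rewrite /off_vec ltnNge i6.
- exists (1 / 700 / 700) => [|A c s symA steps]; first by lra.
  apply: le_trans (parallel_loss_lower_bound perm_es par symA steps) _.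
  by rewrite lerB // (off_sq_nonincreasing symA code6 steps).
- exists (1 / 700 / 700) => [|A c s symA steps]; first by lra.
  have perm_rot1 : perm_eq (rot 1 es) (iota 0 6) by rewrite perm_rot.
  have nth_rot1 k : nth 0%N (rot 1 es) (k %% 6) = nth 0%N es (k.+1 %% 6).
    case: (es) size_es => [|e0 [|e1 [|e2 [|e3 [|e4 [|e5 [|? ?]]]]]]] // _.
    rewrite -[k.+1]addn1 -modnDml; have := ltn_pmod k (isT : 0 < 6)%N.
    by case: (k %% 6)%N => [|[|[|[|[|[|]]]]]].
  have steps1 k : jacobi_step (A k.+1) (A k.+2) (edge (nth 0%N (rot 1 es) (k %% 6))).1
     (edge (nth 0%N (rot 1 es) (k %% 6))).2 (c k.+1) (s k.+1) by rewrite nth_rot1.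
  have := parallel_loss_lower_bound perm_rot1 par (step_sym (steps 0%N)) steps1.
  have := off_sq_nonincreasing symA code6 steps (isT : 15 <= 18)%N.
  have := off_sq_nonincreasing symA code6 steps (isT : 0 <= 1)%N.
  by clear; lra.
Qed.

Lemma uniform_pos (R : realType) (T : eqType) (l : seq T) (P : T -> R -> Prop) :
  (forall x d d', 0 < d' -> d' <= d -> P x d -> P x d') ->
  (forall x, x \in l -> exists2 d, 0 < d & P x d) ->
  exists2 d, 0 < d <= 1 & forall x, x \in l -> P x d.
Proof.
move=> Pmono; elim: l => [|x l IH] H; first by exists 1; rewrite ?ltr01 /=.
have [d1 d1_0 Px] := H x (mem_head _ _).
have [|d2 /andP[d2_0 d2_1] Pl] := IH; first by move=> y yl; apply: H; rewrite inE yl orbT.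
exists (Num.min d1 d2); first by rewrite lt_min d1_0 d2_0 ge_min d2_1 orbT.
have m0 : 0 < Num.min d1 d2 by rewrite lt_min d1_0.
move=> y; rewrite inE => /orP[/eqP ->|/Pl]; first by apply: Pmono Px; rewrite // ge_min lexx.
by apply: Pmono; rewrite // ge_min lexx orbT.
Qed.

Lemma mem_edges (pq : 'I_4 * 'I_4) : (pq \in P4) = (pq \in edges).
Proof.
case: pq => p q; rewrite inE.
by case/or4P: (ord4_cases p) => /eqP ->; case/or4P: (ord4_cases q) => /eqP ->.
Qed.

Lemma ordering_codes (O : 6.-tuple ('I_4 * 'I_4)) :
  is_ordering O ->
  exists2 es, perm_eq es (iota 0 6) &
    forall k, cyclic_strategy O k = edge (nth 0%N es (k %% 6)).
Proof.
move=> [uO memO].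
have memE : O =i edges by move=> pq; rewrite memO mem_edges.
have permO : perm_eq O edges by apply: uniq_perm.
exists [seq index pq edges | pq <- O].
  by rewrite (perm_trans (perm_map (fun pq => index pq edges) permO)).
move=> k; have k6 : (k %% 6 < size O)%N by rewrite size_tuple ltn_mod.
rewrite (nth_map (ord0, ord0)) // /edge nth_index; last by rewrite -memE mem_nth.
by rewrite /cyclic_strategy (tnth_nth (ord0, ord0)).
Qed.

Theorem theorem3 (R : realType) :
  exists gamma : R,
    0 <= gamma < 1 /\
    forall (A : 'M[R]_4) (O : 6.-tuple ('I_4 * 'I_4)) (phi : nat -> R),
      A^T = A ->
      is_ordering O ->
      jacobi_angles (cyclic_strategy O) A phi ->
      forall t : nat, (1 <= t)%N ->
        off_norm (after_sweeps O phi A (t + 3)) <=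
          gamma * off_norm (after_sweeps O phi A t).
Proof.
have [|es|d /andP[d0 d1] H] := @uniform_pos R _ (permutations (iota 0 6)) (fun es delta =>
  forall (A : nat -> 'M[R]_4) (c s : nat -> R),
    (A 0%N)^T = A 0%N ->
    cyclic_jacobi es A c s ->
    delta * off_sq (off_vec (A 0%N)) <= off_sq (off_vec (A 0%N)) - off_sq (off_vec (A 18%N))).
- move=> es d d' d'0 d'd H A c s symA steps; apply: le_trans (H A c s symA steps).
  by rewrite ler_wpM2r ?off_sq_ge0.
- rewrite mem_permutations; exact: three_sweeps_lossy.
exists (Num.sqrt (1 - d)); split.
  by rewrite sqrtr_ge0 /= -[ltRHS]sqrtr1 ltr_sqrt ?ltr01 // ltrBlDr ltrDl.
move=> A O phi symA ordO angles t _.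
have [es perm_es codeE] := ordering_codes ordO.
pose B k := jacobi_iterate (cyclic_strategy O) phi A k.
have pq_neq k : (cyclic_strategy O k).1 != (cyclic_strategy O k).2.
  rewrite codeE; have := ordering_code_lt k perm_es.
  by case: (nth 0%N es (k %% 6)) => [|[|[|[|[|[|e]]]]]] //=.
have symB k : (B k)^T = B k.
  by elim: k => [|k IH] //=; rewrite /B /= !trmx_mul trmxK IH mulmxA.
have steps k : jacobi_step (B k) (B k.+1) (cyclic_strategy O k).1 (cyclic_strategy O k).2
    (cos (phi k)) (sin (phi k)).
  exact: jacobi_angle_step (pq_neq k) (symB k) (angles k).
have es_perm : es \in permutations (iota 0 6) by rewrite mem_permutations.
have window k : jacobi_step (B (6 * t + k)%N) (B (6 * t + k.+1)%N)
    (edge (nth 0%N es (k %% 6))).1 (edge (nth 0%N es (k %% 6))).2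
    (cos (phi (6 * t + k)%N)) (sin (phi (6 * t + k)%N)).
  have := steps (6 * t + k)%N; rewrite codeE addnS.
  by rewrite (_ : (6 * t + k) %% 6 = k %% 6)%N // mulnC modnMDl.
have := H es es_perm (fun k => B (6 * t + k)%N) (fun k => cos (phi (6 * t + k)%N))
  (fun k => sin (phi (6 * t + k)%N)) (symB _) window.
rewrite addn0 => loss.
have {}loss : off_sq (off_vec (B (6 * (t + 3))%N)) <= (1 - d) * off_sq (off_vec (B (6 * t)%N)).
  by rewrite mulnDr -[(6 * 3)%N]/18%N; move: loss; clear; lra.
rewrite /after_sweeps -/(B _) -/(B _) !off_norm_vec -sqrtrM ?subr_ge0 //.
by rewrite ler_wsqrtr.
Qed.
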